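(* Let $d\ge1$, $0<\alpha<1$ and $\beta>1$. Let $\{X_{\mathbf k},\mathbf k\in\mathbb Z_+^d\}$ be i.i.d. copies of $X$ with $\mathbb EX=0$, $\operatorname{Var}X=\sigma^2<\infty$, and suppose $$\mathbb E\big(|X|^{2/\alpha}(\log^+|X|)^{d-1-1/\alpha}\big)<\infty.$$ Let $\Lambda^*=\{\lfloor i^{\beta/(1-\alpha)}\rfloor: i\ge1\}$ and write $\mathbf n\in\Lambda^*$ if every coordinate of $\mathbf n$ belongs to $\Lambda^*$. Then $$\limsup_{\mathbf n\to\infty,\ \mathbf n\in\Lambda^*}\frac{T_{\mathbf n,\mathbf n+\mathbf n^\alpha}}{\sqrt{2|\mathbf n|^\alpha\log|\mathbf n|}}=\sigma\sqrt{\frac{1-\alpha}{\beta}},\qquad \liminf_{\mathbf n\to\infty,\ \mathbf n\in\Lambda^*}\frac{T_{\mathbf n,\mathbf n+\mathbf n^\alpha}}{\sqrt{2|\mathbf n|^\alpha\log|\mathbf n|}}=-\sigma\sqrt{\frac{1-\alpha}{\beta}}\quad\text{a.s.}$$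
   Context: $\mathbb Z_+^d$ is the set of $d$-tuples of positive integers with the coordinatewise partial order. $|\mathbf n|=\prod_{k=1}^d n_k$; $\mathbf n\to\infty$ means every coordinate tends to infinity. $\mathbf n^\alpha=(\lfloor n_1^\alpha\rfloor,\dots,\lfloor n_d^\alpha\rfloor)$. For $\mathbf k\in\mathbb Z_{\ge0}^d$, $T_{\mathbf n,\mathbf n+\mathbf k}=\sum X_{\mathbf j}$ over all $\mathbf j\in\mathbb Z_+^d$ with $n_i<j_i\le n_i+k_i$ for every $i$. $\log^+x=\max\{\log x,1\}$. *)

(* Defs.v *)
From HB Require Import structures.
From mathcomp Require Import all_boot all_order all_algebra.
From mathcomp Require Import all_classical all_reals all_analysis.
Set Implicit Arguments. Unset Strict Implicit. Unset Printing Implicit Defensive.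
Import Order.TTheory GRing.Theory Num.Theory.
Local Open Scope classical_set_scope.
Local Open Scope ring_scope.

Section Defs.
Context {R : realType} {dT : measure_display} {T : measurableType dT}.

Definition Zpos (d : nat) : set {ffun 'I_d -> nat} := [set k | forall i, (0 < k i)%N].

Definition mutually_independent (P : probability T R) (I : eqType) (D : set I)
  (Y : I -> {RV P >-> R}) : Prop :=
  forall (s : seq I) (B : I -> set R),
    uniq s -> (forall i, i \in s -> D i) -> (forall i, measurable (B i)) ->
    P (\big[setI/setT]_(i <- s) (Y i @^-1` B i)) =
    (\prod_(i <- s) P (Y i @^-1` B i))%E.

Definition same_distribution (P : probability T R) (Y X : {RV P >-> R}) : Prop :=
  forall B : set R, measurable B -> P (Y @^-1` B) = P (X @^-1` B).
End Defs.

Definition logplus {R : realType} (x : R) : R := Num.max (ln x) 1.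

Definition normprod (d : nat) (n : {ffun 'I_d -> nat}) : nat := (\prod_(i < d) n i)%N.

Definition npow {R : realType} (d : nat) (alpha : R) (n : {ffun 'I_d -> nat})
  : {ffun 'I_d -> nat} := [ffun i => Num.truncn ((n i)%:R `^ alpha)].

(* T_{n, n+k} = sum of Y_j over n_i < j_i <= n_i + k_i *)
Definition Tbox {U : Type} {R' : nmodType} (d : nat) (Y : {ffun 'I_d -> nat} -> U -> R')
  (n k : {ffun 'I_d -> nat}) (w : U) : R' :=
  (\sum_(t : {dffun forall i : 'I_d, 'I_(k i)}) Y [ffun i => (n i + t i).+1]%N w)%R.

Definition LambdaStar {R : realType} (alpha beta : R) : set nat :=
  [set m | exists2 i : nat, (0 < i)%N & m = Num.truncn ((i%:R : R) `^ (beta / (1 - alpha)))].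

Definition to_infty_in (d : nat) (L : set nat) : set (set {ffun 'I_d -> nat}) :=
  [set V | exists N : nat, [set n : {ffun 'I_d -> nat} | (forall i, L (n i)) /\ (forall i, (N <= n i)%N)] `<=` V].
Arguments Zpos : clear implicits.
Arguments to_infty_in : clear implicits.

(* lim sup / lim inf of f along a family of sets F (as in the library's
   limf_esup / limf_einfE, but for an arbitrary index type) *)
Definition limsup_along {I : Type} {R : realType} (f : I -> \bar R) (F : set (set I)) : \bar R :=
  ereal_inf [set ereal_sup (f @` V) | V in F].
Definition liminf_along {I : Type} {R : realType} (f : I -> \bar R) (F : set (set I)) : \bar R :=
  ereal_sup [set ereal_inf (f @` V) | V in F].

(* Main.v *)
Require Import Defs.
From HB Require Import structures.
From mathcomp Require Import all_boot all_order all_algebra.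
From mathcomp Require Import all_classical all_reals all_analysis.
From mathcomp Require Import measurable_realfun ring lra zify.
Import Order.TTheory GRing.Theory Num.Theory.
Import numFieldNormedType.Exports.
Local Open Scope classical_set_scope.
Local Open Scope ring_scope.

(* Put theta = beta / (1 - alpha) > 1, so that the points of Lambda^* are
   nu j = floor (j^theta), and write L = log |n| and A = |n|^alpha = e^(alpha L).
   Since theta alpha <= theta - 1, consecutive intervals (nu j, nu j + (nu j)^alpha]
   are disjoint, hence the sums T over the boxes at distinct lattice points are
   independent.  It then suffices to show that P (T >= c sqrt (2 A L)) is roughly
   |n|^(- c^2 / sigma^2): as |n| is comparable to (prod_k i_k)^theta, these
   probabilities have a finite sum when c > sigma theta^(-1/2) and an infinite one
   when c < sigma theta^(-1/2), and the two Borel-Cantelli lemmas apply.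

   Because beta > 1, the moment hypothesis is stronger than necessary by a power:
   it gives E |X|^p < oo for some p with alpha (p / 2 - 1) > 1 / theta.  The upper
   bound is then Chernoff's inequality for the variables truncated at A^(1/2 - eps),
   the probability that some variable exceeds this level being summable.

   For the lower bound, split X = f X + g X with f X bounded, both parts centered,
   and g X of small variance.  The upper bound shows that g X contributes little.
   For f X, with S the sum over the box, the moment generating function
   E e^(u S sqrt (2 L / A)) lies between e^(L (u^2 v - k)) and e^(L (u^2 v + k)) for
   small k; comparing its values at u0 - h, u0 and u0 + h shows that the mass of
   e^(u0 S sqrt (2 L / A)) sits where S is close to u0 v sqrt (2 A L), which bounds
   the tail of S from below.  The statement on the lower limit is the one on the
   upper limit for - X. *)

(** * Second order bounds on the exponential *)

Section elementary.
Context {R : realType}.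
Implicit Types x y z : R.

Lemma is_derive_ge0_le (f f' : R -> R) : (forall x, is_derive x 1 f (f' x)) ->
  (forall x, 0 <= f' x) -> {homo f : x y / x <= y}.
Proof.
move=> df f'0 x y xy.
apply: (@ger0_derive1_ndecry _ f x) => // [z _|].
- by rewrite derive1E derive_val.
- apply: continuous_subspaceT => z.
  by apply: differentiable_continuous; apply/derivable1_diffP.
Qed.

(** The derivative is [y * (1 - expR (- y))], whose factors have the same sign. Comparison with the
    value 1 at 0, multiplied by [expR y], places [expR y] below or above
    [1 + y + y ^+ 2 / 2 * expR y] according to the sign of [y]. *)
Lemma expR_taylor2_aux : {homo (fun y => (1 + y) * expR (- y) + y ^+ 2 / 2) : x y / x <= y}.
Proof.
apply: (@is_derive_ge0_le _ (fun y => y * (1 - expR (- y)))) => [x|x].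
  apply: is_derive_eq.
  by rewrite /GRing.scale /= !mulr0; field.
have [x0|x0] := leP 0 x.
  by apply: mulr_ge0 => //; rewrite subr_ge0 expR_le1 oppr_le0.
by apply: mulr_le0; rewrite ?(ltW x0)// subr_le0 -[leLHS](@expR0 R) ler_expR oppr_ge0 ltW.
Qed.

Lemma expR_poly2 : {homo (fun y => expR y - (1 + y + y ^+ 2 / 2)) : x y / x <= y}.
Proof.
apply: (@is_derive_ge0_le _ (fun y => expR y - (1 + y))) => [x|x].
  apply: is_derive_eq.
  by rewrite /GRing.scale /= !mulr0; field.
by rewrite subr_ge0 expR_ge1Dx.
Qed.

(** The remainder depends on an upper bound of [y] only, so that truncation from above will suffice.
    For [y < 0] the quadratic polynomial alone already dominates. *)
Lemma expR_le_taylor2 y z : y <= z -> 0 <= z ->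
  expR y <= 1 + y + y ^+ 2 / 2 * expR z.
Proof.
move=> yz z0; have z1 : 1 <= expR z by rewrite -[leLHS](@expR0 R) ler_expR.
have y20 : 0 <= y ^+ 2 / 2 by rewrite divr_ge0 ?sqr_ge0.
have [y0|y0] := leP 0 y.
  have /= := expR_taylor2_aux _ _ y0.
  rewrite oppr0 expR0 expr0n /= mul0r !addr0 mulr1 => h.
  have : expR y <= ((1 + y) * expR (- y) + y ^+ 2 / 2) * expR y.
    by rewrite ler_peMl ?expR_ge0.
  rewrite mulrDl -mulrA -expRD addNr expR0 mulr1 => /le_trans; apply.
  by rewrite lerD2l ler_wpM2l// ler_expR.
have /= := expR_poly2 _ _ (ltW y0).
rewrite expR0 expr0n /= mul0r !addr0 subrr subr_le0 => /le_trans; apply.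
by rewrite lerD2l ler_peMr.
Qed.

Lemma expR_ge_taylor2 y z : `|y| <= z ->
  1 + y + y ^+ 2 / 2 * expR (- z) <= expR y.
Proof.
move=> yz; have z0 : 0 <= z := le_trans (normr_ge0 _) yz.
have z1 : expR (- z) <= 1 by rewrite expR_le1 oppr_le0.
have y20 : 0 <= y ^+ 2 / 2 by rewrite divr_ge0 ?sqr_ge0.
have [y0|y0] := leP y 0.
  have /= := expR_taylor2_aux _ _ y0.
  rewrite oppr0 expR0 expr0n /= mul0r !addr0 mulr1 => h.
  have : ((1 + y) * expR (- y) + y ^+ 2 / 2) * expR y <= expR y.
    by rewrite ler_piMl ?expR_ge0.
  rewrite mulrDl -mulrA -expRD addNr expR0 mulr1; apply: le_trans.
  rewrite lerD2l ler_wpM2l// ler_expR lerNl.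
  by rewrite (le_trans _ yz)// ler0_norm.
have /= := expR_poly2 _ _ (ltW y0).
rewrite expR0 expr0n /= mul0r !addr0 subrr subr_ge0; apply: le_trans.
by rewrite lerD2l ler_piMr.
Qed.

(** Inverse of [1 - z / (1 + z) <= expR (- (z / (1 + z)))], whose left side is [(1 + z)^-1]. It
    bounds products of factors [1 + y] from below by exponentials. *)
Lemma expR_div1D_le z : 0 <= z -> expR (z / (1 + z)) <= 1 + z.
Proof.
move=> z0; have z1 : 0 < 1 + z by rewrite ltr_wpDr.
rewrite -[leRHS]invrK -[leLHS]invrK lef_pV2 ?posrE ?invr_gt0 ?expR_gt0//.
rewrite -expRN (le_trans _ (expR_ge1Dx _))//.
by rewrite -[X in X - _](@divff _ (1 + z)) ?gt_eqF// -mulrBl addrK mul1r.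
Qed.

End elementary.

(** * Independence *)

Section independence.
Context {R : realType} {dT : measure_display} {T : measurableType dT}.
Variable P : probability T R.

Import HBNNSimple.

(** Factorization against indicators passes to simple functions by linearity and to [f] by monotone
    convergence. Independence enters only through the last hypothesis, so [Z] may be a product over
    other variables. *)
Lemma ge0_integral_indep (Z : T -> R) (Y : {RV P >-> R}) (f : R -> R) :
  measurable_fun setT Z -> (forall w, 0 <= Z w) ->
  measurable_fun setT f -> (forall x, 0 <= f x) ->
  (\int[P]_w (Z w)%:E < +oo)%E ->
  (forall B, measurable B ->
     \int[P]_w (Z w * \1_B (Y w))%:E = \int[P]_w (Z w)%:E * P (Y @^-1` B))%E ->
  (\int[P]_w (Z w * f (Y w))%:E = \int[P]_w (Z w)%:E * \int[P]_w (f (Y w))%:E)%E.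
Proof.
move=> mZ Z0 mf f0 Zoo ZB.
have mY : measurable_fun setT (Y : T -> R) by [].
have mef : measurable_fun setT (fun x => (f x)%:E) by exact/measurable_EFinP.
pose g := nnsfun_approx measurableT mef.
have gf x : (EFin \o g ^~ x) @ \oo --> (f x)%:E.
  by apply: (cvg_nnsfun_approx measurableT mef) => // y _; rewrite lee_fin.
have mgY n : measurable_fun setT (fun w => g n (Y w)).
  by apply: (measurableT_comp (f := g n)) => //; exact: measurable_funP.
have ndg x : nondecreasing_seq (fun n => g n x).
  by move=> m n mn; exact/lefP/nd_nnsfun_approx.
have int_simple n : (\int[P]_w (Z w * g n (Y w))%:E
    = \int[P]_w (Z w)%:E * \int[P]_w (g n (Y w))%:E)%E.
  have mI k : measurable (g n @^-1` [set k]) by exact: measurable_funPTI.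
  have mZI k : measurable_fun setT (fun w => Z w * \1_(g n @^-1` [set k]) (Y w)).
    apply: measurable_funM => //.
    exact: measurableT_comp (measurable_indic (mI k)) mY.
  have gE w : g n (Y w) = \sum_(k \in range (g n)) k * \1_(g n @^-1` [set k]) (Y w).
    by rewrite [LHS](fimfunE (g n)).
  have gk0 k x : 0 <= k * \1_(g n @^-1` [set k]) x.
    by have := nnfun_muleindic_ge0 (g n) k x; rewrite lee_fin.
  transitivity (\sum_(k \in range (g n))
      (k%:E * \int[P]_w (Z w * \1_(g n @^-1` [set k]) (Y w))%:E))%E.
    under eq_integral do rewrite gE mulr_fsumr -fsumEFin//.
    rewrite ge0_integral_fsum//; last 2 first.
    - move=> k; apply/measurable_EFinP.
      under eq_fun do rewrite mulrCA.
      exact: measurable_funM.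
    - by move=> k w _; rewrite lee_fin mulr_ge0.
    apply: eq_fsbigr => k _.
    under eq_integral do rewrite mulrCA EFinM.
    have [k0|k0] := leP 0 k.
      by rewrite ge0_integralZl_EFin// => [w _|]; [rewrite lee_fin mulr_ge0|exact/measurable_EFinP].
    have -> : g n @^-1` [set k] = set0.
      apply/seteqP; split => // x /= gx; have : 0 <= g n x by [].
      by rewrite gx leNgt k0.
    under eq_integral do rewrite indic0 mulr0 mule0.
    rewrite integral0.
    by under eq_integral do rewrite indic0 mulr0; rewrite integral0 mule0.
  have c0 k : (0 <= k%:E * P (Y @^-1` (g n @^-1` [set k])))%E.
    exact: (nnsfun_mulemu_ge0 (pushforward P Y) (g n)).
  have intP k : (\int[P]_w (\1_(g n @^-1` [set k]) (Y w))%:E = P (Y @^-1` (g n @^-1` [set k])))%E.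
    have mYI := mY measurableT _ (mI k); rewrite setTI in mYI.
    rewrite -[X in P X]setIT -(integral_indic _ measurableT mYI).
    by apply: eq_integral.
  transitivity (\int[P]_w (Z w)%:E * \sum_(k \in range (g n))
      (k%:E * P (Y @^-1` (g n @^-1` [set k]))))%E.
    rewrite ge0_mule_fsumr//; apply: eq_fsbigr => k _.
    by rewrite ZB// muleCA.
  congr (_ * _)%E.
  under [RHS]eq_integral do rewrite gE -fsumEFin//.
  rewrite ge0_integral_fsum//; last 2 first.
  - move=> k; apply/measurable_EFinP; apply: measurable_funM => //.
    exact: measurableT_comp (measurable_indic (mI k)) mY.
  - by move=> k w _; rewrite lee_fin.
  apply: eq_fsbigr => k _.
  under [RHS]eq_integral do rewrite EFinM.
  have [k0|k0] := leP 0 k.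
    rewrite ge0_integralZl_EFin// ?intP//.
    by apply/measurable_EFinP; exact: measurableT_comp (measurable_indic (mI k)) mY.
  have -> : g n @^-1` [set k] = set0.
    apply/seteqP; split => // x /= gx; have : 0 <= g n x by [].
    by rewrite gx leNgt k0.
  under eq_integral do rewrite indic0 mule0.
  by rewrite preimage_set0 measure0 integral0 mule0.
have fin : (\int[P]_w (Z w)%:E)%E \is a fin_num.
  by rewrite ge0_fin_numE// integral_ge0// => w _; rewrite lee_fin.
have cvgl : (\int[P]_w (Z w * g n (Y w))%:E @[n --> \oo] --> \int[P]_w (Z w * f (Y w))%:E)%E.
  rewrite (_ : \int[P]_w (Z w * f (Y w))%:E =
     \int[P]_w (limn (fun n => (Z w * g n (Y w))%:E)))%E.
    apply: cvg_monotone_convergence => //.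
    - by move=> n; apply/measurable_EFinP; apply: measurable_funM.
    - by move=> n w _; rewrite lee_fin mulr_ge0.
    - by move=> w _ m n mn; rewrite lee_fin ler_wpM2l// ndg.
  apply: eq_integral => w _; apply/esym/cvg_lim => //.
  under eq_fun do rewrite EFinM.
  by rewrite EFinM; apply: cvgeZl => //; exact: gf.
have cvgr : (\int[P]_w (g n (Y w))%:E @[n --> \oo] --> \int[P]_w (f (Y w))%:E)%E.
  rewrite (_ : \int[P]_w (f (Y w))%:E = \int[P]_w (limn (fun n => (g n (Y w))%:E)))%E.
    apply: cvg_monotone_convergence => //.
    - by move=> n; apply/measurable_EFinP.
    - by move=> n w _; rewrite lee_fin.
    - by move=> w _ m n mn; rewrite lee_fin ndg.
  by apply: eq_integral => w _; apply/esym/cvg_lim => //; exact: gf.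
apply: (cvg_unique _ cvgl) => //.
rewrite (funext int_simple).
exact: cvgeZl.
Qed.

Section family.
Context {I : choiceType}.
Variables (D : set I) (Y : I -> {RV P >-> R}).
Hypothesis indY : mutually_independent D Y.

Lemma measurable_bigsetI_preimage (s : seq I) (B : I -> set R) :
  (forall i, measurable (B i)) ->
  measurable (\big[setI/setT]_(i <- s) (Y i @^-1` B i)).
Proof.
move=> mB; apply: bigsetI_measurable => i _.
by rewrite -[X in measurable X]setTI; exact: measurable_funPT.
Qed.

Lemma indic_bigsetI_preimage (s : seq I) (B : I -> set R) w :
  \1_(\big[setI/setT]_(i <- s) (Y i @^-1` B i)) w
    = \prod_(i <- s) \1_(B i) (Y i w) :> R.
Proof.
elim: s => [|i s IH]; first by rewrite !big_nil indicT.
by rewrite !big_cons indicI/= IH.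
Qed.

(** Indicators are replaced by functions one index at a time: the factorization that
    [ge0_integral_indep] asks for at [j] is the induction hypothesis with [j] moved into the list of
    indicators. For [s1] empty this is the definition of independence. *)
Lemma integral_prod_indic (f : I -> R -> R) (s1 s2 : seq I) (B : I -> set R) :
  (forall i, measurable_fun setT (f i)) -> (forall i x, 0 <= f i x) ->
  (forall i, D i -> (\int[P]_w (f i (Y i w))%:E < +oo)%E) ->
  uniq (s1 ++ s2) -> (forall i, i \in s1 ++ s2 -> D i) -> (forall i, measurable (B i)) ->
  (\int[P]_w (\prod_(i <- s1) f i (Y i w) * \prod_(i <- s2) \1_(B i) (Y i w))%:E
   = \prod_(i <- s1) (\int[P]_w (f i (Y i w))%:E) * \prod_(i <- s2) P (Y i @^-1` B i))%E.
Proof.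
move=> mf f0 foo.
elim: s1 s2 B => [|j s1 IH] s2 B us sD mB.
  rewrite big_nil mul1e -(indY s2 B us)//.
  under eq_integral do rewrite big_nil mul1r -indic_bigsetI_preimage.
  by rewrite integral_indic// ?setIT//; exact: measurable_bigsetI_preimage.
pose Z w := \prod_(i <- s1) f i (Y i w) * \prod_(i <- s2) \1_(B i) (Y i w) : R.
have us12 : uniq (s1 ++ s2) by move: us => /= /andP[].
have sD12 i : i \in s1 ++ s2 -> D i.
  by move=> ?; apply: sD; rewrite /= inE; apply/orP; right.
have IHZ := IH s2 B us12 sD12 mB.
have Dj : D j by apply: sD; rewrite inE eqxx.
have mZ : measurable_fun setT Z.
  apply: measurable_funM; apply: measurable_prod => i _.
    exact: measurableT_comp (mf i) _.
  exact: measurableT_comp (measurable_indic (mB i)) _.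
have Z0 w : 0 <= Z w by apply: mulr_ge0; apply: prodr_ge0.
transitivity (\int[P]_w (Z w)%:E * \int[P]_w (f j (Y j w))%:E)%E; last first.
  by rewrite IHZ big_cons muleC muleA.
rewrite -ge0_integral_indep//.
- by apply: eq_integral => w _; rewrite big_cons -mulrA mulrC.
- have fin : (\prod_(i <- s1) \int[P]_w (f i (Y i w))%:E
      * \prod_(i <- s2) P (Y i @^-1` B i))%E \is a fin_num.
    apply: fin_numM; rewrite big_seq; apply: (big_ind (fun x : \bar R => x \is a fin_num)) => //.
    + by move=> x y xf yf; apply: fin_numM.
    + move=> i i1; rewrite ge0_fin_numE ?foo//.
        by apply: sD12; rewrite mem_cat i1.
      by apply: integral_ge0 => w _; rewrite lee_fin.
    + by move=> x y xf yf; apply: fin_numM.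
    + by move=> i i2; apply: fin_num_measure; rewrite -[X in measurable X]setTI; exact: measurable_funPT.
  by rewrite IHZ ltey_eq fin.
- move=> B0 mB0.
  pose B' i := if i == j then B0 else B i.
  have jn : j \notin s1 ++ s2 by move: us => /= /andP[].
  have jn2 i : i \in s2 -> (i == j) = false.
    by move=> i2; apply/negP => /eqP ij; move: jn; rewrite mem_cat -ij i2 orbT.
  have us' : uniq (s1 ++ j :: s2).
    by rewrite -(cat1s j s2) uniq_catCA.
  have := IH (j :: s2) B' us'.
  have -> : (\prod_(i <- j :: s2) P (Y i @^-1` B' i) = P (Y j @^-1` B0) * \prod_(i <- s2) P (Y i @^-1` B i))%E.
    rewrite big_cons {1}/B' eqxx; congr (_ * _)%E.
    by apply: eq_big_seq => i /jn2 ij; rewrite /B' ij.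
  rewrite IHZ muleCA muleC => <-.
  + apply: eq_integral => w _; rewrite /Z -mulrA; congr (_ * _)%:E.
    rewrite big_cons mulrC {1}/B' eqxx; congr (_ * _).
    by apply: eq_big_seq => i /jn2 ij; rewrite /B' ij.
  + move=> i; rewrite mem_cat inE orbCA -mem_cat => h; apply: sD.
    by rewrite inE.
  + by move=> i; rewrite /B'; case: ifP.
Qed.

Lemma integral_prod_indep (f : I -> R -> R) (s : seq I) :
  (forall i, measurable_fun setT (f i)) -> (forall i x, 0 <= f i x) ->
  (forall i, D i -> (\int[P]_w (f i (Y i w))%:E < +oo)%E) ->
  uniq s -> (forall i, i \in s -> D i) ->
  (\int[P]_w (\prod_(i <- s) f i (Y i w))%:E
   = \prod_(i <- s) (\int[P]_w (f i (Y i w))%:E))%E.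
Proof.
move=> mf f0 foo us sD.
have := @integral_prod_indic f s [::] (fun=> setT) mf f0 foo.
rewrite cats0 => /(_ us sD (fun=> measurableT)).
rewrite big_nil mule1 => <-.
by apply: eq_integral => w _; rewrite big_nil mulr1.
Qed.

(** A pi-system that generates the sigma-algebra of the variables [Y i] with [i] in [s]. *)
Definition cylinders (s : seq I) : set (set T) :=
  [set A | exists2 B : I -> set R, (forall i, measurable (B i)) &
     A = \big[setI/setT]_(i <- s) (Y i @^-1` B i)].

Lemma cylinders_measurable s : cylinders s `<=` measurable.
Proof. by move=> _ [B mB ->]; exact: measurable_bigsetI_preimage. Qed.

Lemma cylinders_setI_closed s : setI_closed (cylinders s).
Proof.
move=> _ _ [B mB ->] [C mC ->]; exists (fun i => B i `&` C i).
  by move=> i; exact: measurableI.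
by rewrite -big_split.
Qed.

Lemma cylindersT s : cylinders s setT.
Proof. by exists (fun=> setT) => //; rewrite big1. Qed.

(** The pi-lambda method, one block at a time. The extra cylinder [C] carries the induction: when
    the event of block [j] is itself a cylinder, it is absorbed into [C], and [s j] is joined to
    [s0]. *)
Lemma indep_sigma_cylinders {J : eqType} (js : seq J) (s : J -> seq I) (E : J -> set T)
    (s0 : seq I) (C : set T) :
  (forall j, j \in js -> <<s cylinders (s j) >> (E j)) -> cylinders s0 C ->
  uniq (flatten (map s js) ++ s0) ->
  (forall i, i \in flatten (map s js) ++ s0 -> D i) ->
  P (\big[setI/setT]_(j <- js) E j `&` C) = (\prod_(j <- js) P (E j) * P C)%E.
Proof.
have sm s' : <<s cylinders s' >> `<=` measurable.
  apply: smallest_sub; last exact: cylinders_measurable.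
  exact: sigma_algebra_measurable.
elim: js s0 C => [|j js IH] s0 C sE cC us sD.
  by rewrite !big_nil setTI mul1e.
rewrite !big_cons.
have sE' i : i \in js -> <<s cylinders (s i) >> (E i).
  by move=> ijs; apply: sE; rewrite inE ijs orbT.
set Rest := \big[setI/setT]_(j <- js) E j.
have mRest : measurable Rest.
  rewrite /Rest big_seq; apply: big_ind => //.
    by move=> A B mA mB; exact: measurableI.
  by move=> i /sE' /sm.
have mC : measurable C by exact: cylinders_measurable cC.
have mRC : measurable (Rest `&` C) by exact: measurableI.
have us0 : uniq (flatten (map s js) ++ s0).
  by move: us; rewrite /= -catA cat_uniq => /and3P[].
have sD0 i : i \in flatten (map s js) ++ s0 -> D i.
  by move=> ?; apply: sD; rewrite /= -catA mem_cat; apply/orP; right.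
pose r := fine (P (Rest `&` C)).
have r0 : 0 <= r by exact: fine_ge0.
(* As functions of [A] both sides are finite measures, so it is enough that they agree on the
   pi-system of cylinders over [s j]. *)
suff H A : <<s cylinders (s j) >> A -> P (A `&` (Rest `&` C)) = (P (Rest `&` C) * P A)%E.
  have sEj : <<s cylinders (s j) >> (E j) by apply: sE; rewrite inE eqxx.
  have IHC : (P (Rest `&` C) = \prod_(j <- js) P (E j) * P C)%E by exact: (IH s0 C sE' cC us0 sD0).
  by rewrite -setIA (H _ sEj) IHC muleC muleA.
move=> sA.
transitivity (mscale (NngNum r0) P A); last first.
  by rewrite /mscale /= fineK// fin_num_measure.
apply: (@g_sigma_algebra_measure_unique _ _ _ (cylinders (s j)) _ (fun=> setT) _ _
  (mrestr P mRC) (mscale (NngNum r0) P)) => //.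
- exact: cylinders_measurable.
- by move=> _; exact: cylindersT.
- by rewrite bigcup_const.
- exact: cylinders_setI_closed.
- move=> A' [B mB A'E]; rewrite /= /mrestr /mscale /= fineK ?fin_num_measure//.
  case: cC => B0 mB0 CE.
  have usj : uniq (s j ++ s0).
    move: us; rewrite /= -catA cat_uniq => /and3P[uj + _].
    rewrite has_cat negb_or => /andP[_ h].
    by move: us0; rewrite cat_uniq => /and3P[_ _ u0]; rewrite cat_uniq uj h u0.
  pose B' i := if i \in s j then B i else B0 i.
  have mB' i : measurable (B' i) by rewrite /B'; case: ifP.
  have js0 i : i \in s0 -> i \in s j = false.
    move=> i0; apply/negP => ij; move: usj; rewrite cat_uniq => /and3P[_ /hasP + _].
    by apply; exists i.
  have ACE : A' `&` C = \big[setI/setT]_(i <- s j ++ s0) (Y i @^-1` B' i).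
    rewrite A'E CE big_cat; congr (_ `&` _); apply: eq_big_seq => i.
      by rewrite /B' => ->.
    by move=> /js0; rewrite /B' => ->.
  rewrite setICA (IH (s j ++ s0))//; last 3 first.
  + by exists B'.
  + by move: us; rewrite /= -catA uniq_catCA.
  + move=> i; rewrite !mem_cat orbCA => h; apply: sD.
    by rewrite /= -catA !mem_cat.
  rewrite (IH s0)//; last by exists B0.
  rewrite ACE (indY _ B' usj)//; last first.
    move=> i ijs; apply: sD; rewrite /= -catA !mem_cat.
    by move: ijs; rewrite mem_cat => /orP[->|->]//; rewrite !orbT.
  rewrite A'E (indY (s j) B)//; last 2 first.
  + by move: usj; rewrite cat_uniq => /andP[].
  + by move=> i ij; apply: sD; rewrite /= -catA mem_cat ij.
  rewrite CE (indY s0 B0)//; last 2 first.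
  + by move: us0; rewrite cat_uniq => /and3P[].
  + by move=> i i0; apply: sD0; rewrite mem_cat i0 orbT.
  rewrite big_cat /=.
  have -> : (\prod_(i <- s j) P (Y i @^-1` B' i) = \prod_(i <- s j) P (Y i @^-1` B i))%E.
    by apply: eq_big_seq => i; rewrite /B' => ->.
  have -> : (\prod_(i <- s0) P (Y i @^-1` B' i) = \prod_(i <- s0) P (Y i @^-1` B0 i))%E.
    by apply: eq_big_seq => i /js0; rewrite /B' => ->.
  by rewrite -muleA; congr (_ * _)%E; rewrite muleC.
- move=> k; rewrite /= /mrestr setTI.
  by rewrite ltey_eq fin_num_measure.
Qed.

Lemma sum_cylinders (s : seq I) (B : set R) : measurable B ->
  <<s cylinders s >> ((fun w => \sum_(i <- s) Y i w) @^-1` B).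
Proof.
move=> mB.
(* The space [T] with the smaller sigma-algebra; it remains to see that the sum is measurable for
   it. *)
pose T' := g_sigma_algebraType (cylinders s).
have mY i : i \in s -> measurable_fun setT (Y i : T' -> R).
  move=> ins _ C mC; rewrite setTI; apply: sub_sigma_algebra.
  exists (fun j => if j == i then C else setT).
    by move=> j; case: ifP.
  rewrite -bigcap_seq; apply/seteqP; split => [w /= Cw k _ /=|w /= /(_ i ins)].
    by case: eqP => [->|].
  by rewrite eqxx.
(* The guard makes the term measurable for every index, since outside [s] nothing is known about
   [Y i] on [T']. *)
have : measurable_fun setT (fun w : T' => \sum_(i <- s) (if i \in s then Y i w else 0)).
  apply: measurable_sum => i; case: (boolP (i \in s)) => [/mY//|_]; exact: measurable_cst.
move=> /(_ measurableT B mB); rewrite setTI.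
rewrite (_ : _ @^-1` B = (fun w => \sum_(i <- s) Y i w) @^-1` B)//.
apply: funext => w /=; congr (B _).
by rewrite big_seq [RHS]big_seq; apply: eq_bigr => i ->.
Qed.

End family.
End independence.

(** * Exponential inequalities *)

Section deviation.
Context {R : realType} {dT : measure_display} {T : measurableType dT}.
Variable P : probability T R.

Lemma measure_bigsetU_seq_le {I : eqType} (s : seq I) (A : I -> set T) :
  (forall i, measurable (A i)) ->
  (P (\big[setU/set0]_(i <- s) A i) <= \sum_(i <- s) P (A i))%E.
Proof.
move=> mA; elim: s => [|i s IH]; first by rewrite !big_nil measure0.
rewrite !big_cons (le_trans (measureU2 _ _ _))//; first by exact: bigsetU_measurable.
exact: leeD.
Qed.

Lemma probability_le_integral (A : set T) (f : T -> R) :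
  measurable A -> measurable_fun setT f -> (forall w, 0 <= f w) ->
  (forall w, A w -> 1 <= f w) -> (P A <= \int[P]_w (f w)%:E)%E.
Proof.
move=> mA mf f0 Af; rewrite -[A]setIT -integral_indic//.
apply: ge0_le_integral => //.
- by apply/measurable_EFinP; exact: measurable_indic.
- exact/measurable_EFinP.
- move=> w _; rewrite lee_fin indicE; case: (boolP (w \in A)) => // /set_mem.
  exact: Af.
Qed.

Lemma integral_quadratic (Y : {RV P >-> R}) (v a b c : R) :
  P.-integrable setT (EFin \o Y) -> (\int[P]_w (Y w)%:E = 0)%E ->
  (\int[P]_w ((Y w) ^+ 2)%:E = v%:E)%E ->
  (\int[P]_w (a + b * Y w + c * Y w ^+ 2)%:E = (a + c * v)%:E)%E.
Proof.
move=> iY Y0 Yv.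
have i1 : P.-integrable setT (fun=> a%:E).
  by apply: finite_measure_integrable_cst.
have iY2 : P.-integrable setT (fun w => (Y w ^+ 2)%:E).
  apply/integrableP; split.
    by apply/measurable_EFinP; exact: measurable_funX.
  by under eq_integral do rewrite gee0_abs ?lee_fin ?sqr_ge0//; rewrite Yv ltry.
under eq_integral do rewrite 2!EFinD 2!EFinM.
rewrite integralD//; last 2 first.
- by apply: integrableD => //; apply: integrableZl.
- exact: integrableZl.
rewrite integralD//; last exact: integrableZl.
have -> : (\int[P]_w a%:E = a%:E)%E by rewrite integral_cst// [X in (_ * X)%E]probability_setT mule1.
rewrite !integralZl//.
by rewrite Y0 Yv mule0 adde0 EFinD EFinM.
Qed.

Lemma markov_powR (Y : {RV P >-> R}) (p C b : R) : 0 < b -> 0 <= p ->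
  (\int[P]_w (`|Y w| `^ p)%:E <= C%:E)%E ->
  (P [set w | (b <= `|Y w|)%R] <= (C / b `^ p)%:E)%E.
Proof.
move=> b0 p0 YC.
have bp : 0 < b `^ p by exact: powR_gt0.
have := @markov _ _ _ P Y (fun x => x `^ p) b b0 (@measurable_powR _ p).
move=> /(_ (fun r _ => powR_ge0 r p)).
have -> : [set x | (b%:E <= `|(Y x)%:E|)%E] = [set w | b <= `|Y w|].
  by apply/funext => w /=; rewrite lee_fin.
rewrite unlock /= => h; rewrite EFinM muleC lee_pdivlMl//.
rewrite (le_trans (h _))//.
by move=> x y /=; rewrite !nnegrE => x0 y0 xy; exact: ge0_ler_powR.
Qed.

Section family.
Context {I : choiceType}.
Variables (D : set I) (Y : I -> {RV P >-> R}).
Hypothesis indY : mutually_independent D Y.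

(** Only large positive values are removed, and they become 0 rather than [b]; very negative values
    are kept. *)
Definition truncate (b x : R) : R := x * \1_(`]-oo, b]) x.

Lemma measurable_truncate b : measurable_fun setT (truncate b).
Proof. by apply: measurable_funM => //; exact: measurable_indic. Qed.

Lemma truncateE b x : truncate b x = if x <= b then x else 0.
Proof.
rewrite /truncate indicE; case: ifPn => xb.
  by rewrite mem_set ?mulr1//= in_itv.
by rewrite memNset ?mulr0//= in_itv/=; exact/negP.
Qed.

(** The pointwise bound is a quadratic in the untruncated [X], so truncation does not disturb the
    centering. Where [X > b] the exponential is 1, and the quadratic is at least 1 because [X] is
    positive there. *)
Lemma mgf_truncate_le (X : {RV P >-> R}) (v t b : R) :
  P.-integrable setT (EFin \o X) -> (\int[P]_w (X w)%:E = 0)%E ->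
  (\int[P]_w ((X w) ^+ 2)%:E = v%:E)%E -> 0 <= t -> 0 <= b ->
  (\int[P]_w (expR (t * truncate b (X w)))%:E
     <= (expR (t ^+ 2 * expR (t * b) / 2 * v))%:E)%E.
Proof.
move=> iX X0 Xv t0 b0.
pose c := t ^+ 2 * expR (t * b) / 2.
apply: (@le_trans _ _ (\int[P]_w (1 + t * X w + c * X w ^+ 2)%:E)%E); last first.
  rewrite (integral_quadratic _ v)// lee_fin; exact: expR_ge1Dx.
have c0 : 0 <= c by rewrite /c divr_ge0// mulr_ge0 ?sqr_ge0 ?expR_ge0.
have le w : expR (t * truncate b (X w)) <= 1 + t * X w + c * X w ^+ 2.
  rewrite truncateE; case: ifPn => [Xb|].
    rewrite (le_trans (@expR_le_taylor2 _ _ (t * b) _ _))//.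
    - by rewrite ler_wpM2l.
    - by rewrite mulr_ge0.
    - by rewrite lerD2l /c le_eqVlt; apply/orP; left; apply/eqP; field.
  rewrite -ltNge => bX; rewrite mulr0 expR0 -addrA lerDl addr_ge0// mulr_ge0 ?sqr_ge0//.
  by rewrite ltW// (le_lt_trans b0).
have mX : measurable_fun setT X by [].
apply: ge0_le_integral => //.
- apply/measurable_EFinP; apply: measurableT_comp => //.
  apply: measurable_funM => //; exact: measurableT_comp (measurable_truncate b) mX.
- apply/measurable_EFinP; apply: measurable_funD; first apply: measurable_funD => //.
    exact: measurable_funM.
  by apply: measurable_funM => //; exact: measurable_funX.
- by move=> w _; rewrite lee_fin.
Qed.

(** Unless some [|Y i|] reaches [b], the sum equals the sum of the truncated variables. The
    exceptional event is handled by a union bound and Markov's inequality of order [p], the other by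
    Chernoff's inequality at [t]. *)
Lemma fuk_nagaev (v p C t b x : R) (s : seq I) :
  (forall i, D i -> P.-integrable setT (EFin \o Y i)) ->
  (forall i, D i -> \int[P]_w (Y i w)%:E = 0)%E ->
  (forall i, D i -> \int[P]_w ((Y i w) ^+ 2)%:E = v%:E)%E ->
  (forall i, D i -> \int[P]_w (`|Y i w| `^ p)%:E <= C%:E)%E ->
  0 <= p -> 0 <= t -> 0 < b -> uniq s -> (forall i, i \in s -> D i) ->
  (P [set w | (x <= \sum_(i <- s) Y i w)%R]
    <= (expR (- (t * x) + (size s)%:R * (t ^+ 2 * expR (t * b) / 2 * v))
        + (size s)%:R * (C / b `^ p))%:E)%E.
Proof.
move=> iY Y0 Yv YC p0 t0 b0 us sD.
pose A := [set w | x <= \sum_(i <- s) truncate b (Y i w)].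
pose B i := [set w | b <= `|Y i w|].
have mY i : measurable_fun setT (Y i) by [].
have mtY i : measurable_fun setT (fun w => truncate b (Y i w)).
  exact: measurableT_comp (measurable_truncate b) (mY i).
have mtail (f : T -> R) (y : R) : measurable_fun setT f -> measurable [set w | y <= f w].
  move=> mf; have := mf measurableT `[y, +oo[%classic (measurable_itv _).
  rewrite setTI; congr measurable.
  by apply/funext => w /=; rewrite in_itv/= andbT.
have mA : measurable A by apply: mtail; exact: measurable_sum.
have mB i : measurable (B i) by apply: mtail; exact: measurableT_comp.
have mBs : measurable (\big[setU/set0]_(i <- s) B i) by exact: bigsetU_measurable.
apply: (@le_trans _ _ (P (A `|` \big[setU/set0]_(i <- s) B i))).
  apply: le_measure; rewrite ?inE.
  - by apply: mtail; exact: measurable_sum.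
  - exact: measurableU.
  move=> w /= xw; have [|/hasPn nB] := boolP (has (fun i => b <= `|Y i w|) s).
    move=> /hasP[i si bi]; right; rewrite -bigcup_seq; by exists i.
  left; rewrite /A /=; move: xw; congr (_ <= _).
  apply: eq_big_seq => i /nB; rewrite -ltNge => Yb; rewrite truncateE ifT//.
  by rewrite (le_trans (ler_norm _))// ltW.
rewrite (le_trans (measureU2 _ _ _))// EFinD leeD//; last first.
  rewrite (le_trans (measure_bigsetU_seq_le _ _ _))//.
  have -> : ((size s)%:R * (C / b `^ p))%:E = (\sum_(i <- s) (C / b `^ p)%:E)%E.
    by rewrite sumEFin big_const_seq count_predT iter_addr_0 mulr_natl.
  rewrite big_seq [leRHS]big_seq; apply: lee_sum => i /sD Di.
  by apply: markov_powR => //; exact: YC.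
have mexp i : measurable_fun setT (fun w => expR (t * truncate b (Y i w))).
  by apply: measurableT_comp => //; exact: measurable_funM.
pose f (_ : I) y := expR (t * truncate b y).
have mf i : measurable_fun setT (f i).
  apply: measurableT_comp => //; apply: measurable_funM => //; exact: measurable_truncate.
have mgf i : D i -> (\int[P]_w (f i (Y i w))%:E
     <= (expR (t ^+ 2 * expR (t * b) / 2 * v))%:E)%E.
  by move=> Di; apply: mgf_truncate_le; rewrite ?(ltW b0) //; [exact: iY|exact: Y0|exact: Yv].
have f0 i y : 0 <= f i y by exact: expR_ge0.
apply: (le_trans (probability_le_integral A (fun w =>
   expR (- (t * x)) * \prod_(i <- s) f i (Y i w)) _ _ _ _)) => //.
- by apply: measurable_funM => //; apply: measurable_prod => i _; exact: mexp.
- by move=> w; apply: mulr_ge0; [exact: expR_ge0|exact: prodr_ge0].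
- move=> w Aw; rewrite -expR_sum -expRD -[leLHS](@expR0 R) ler_expR addrC subr_ge0.
  by rewrite -mulr_sumr ler_wpM2l.
under eq_integral do rewrite EFinM.
rewrite ge0_integralZl_EFin ?expR_ge0//; last 2 first.
- by move=> w _; rewrite lee_fin; exact: prodr_ge0.
- by apply/measurable_EFinP; apply: measurable_prod => i _; exact: mexp.
rewrite expRD EFinM lee_pmul2l ?lte_fin ?expR_gt0//.
rewrite (integral_prod_indep _ D Y indY f s)//; last first.
  by move=> i /mgf /le_lt_trans; apply; rewrite ltry.
have -> : expR ((size s)%:R * (t ^+ 2 * expR (t * b) / 2 * v))
   = \prod_(i <- s) expR (t ^+ 2 * expR (t * b) / 2 * v).
  by rewrite expRM_natl big_const_seq count_predT iter_mulr_1.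
rewrite -prodEFin big_seq [leRHS]big_seq.
(* Nonnegativity is carried along because multiplying inequalities needs it. *)
have : ((0 <= \prod_(i <- s | i \in s) \int[P]_w (f i (Y i w))%:E) &&
  (\prod_(i <- s | i \in s) \int[P]_w (f i (Y i w))%:E
    <= \prod_(i <- s | i \in s) (expR (t ^+ 2 * expR (t * b) / 2 * v))%:E))%E.
  elim/big_ind2 : _ => //.
  - by rewrite lee01 lexx.
  - move=> x1 x2 y1 y2 /andP[x10 x12] /andP[y10 y12].
    by rewrite mule_ge0//= lee_pmul.
  - move=> i /sD /mgf ->; rewrite andbT.
    by apply: integral_ge0 => w _; rewrite lee_fin.
by move=> /andP[].
Qed.

(** A variable bounded by [B] equals its truncation at [B]. *)
Lemma mgf_bounded_le (X : {RV P >-> R}) (v t B : R) :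
  (forall w, `|X w| <= B) -> (\int[P]_w (X w)%:E = 0)%E ->
  (\int[P]_w ((X w) ^+ 2)%:E = v%:E)%E -> 0 <= t -> 0 <= B ->
  (\int[P]_w (expR (t * X w))%:E <= (expR (t ^+ 2 * expR (t * B) / 2 * v))%:E)%E.
Proof.
move=> XB X0 Xv t0 B0.
have iX : P.-integrable setT (EFin \o X).
  apply: measurable_bounded_integrable => //.
    by rewrite ltey_eq fin_num_measure.
  exists B; split; first exact: num_real.
  by move=> x Bx w _ /=; rewrite (le_trans (XB w))// ltW.
rewrite (le_trans _ (mgf_truncate_le X v t B iX X0 Xv t0 B0))// le_eqVlt.
apply/orP; left; apply/eqP; apply: eq_integral => w _.
by rewrite truncateE ifT// (le_trans (ler_norm _)).
Qed.

Lemma mgf_bounded_ge (X : {RV P >-> R}) (v t B : R) :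
  (forall w, `|X w| <= B) -> (\int[P]_w (X w)%:E = 0)%E ->
  (\int[P]_w ((X w) ^+ 2)%:E = v%:E)%E -> 0 <= t -> 0 <= B -> 0 <= v ->
  ((1 + t ^+ 2 * expR (- (t * B)) / 2 * v)%:E <= \int[P]_w (expR (t * X w))%:E)%E.
Proof.
move=> XB X0 Xv t0 B0 v0.
have iX : P.-integrable setT (EFin \o X).
  apply: measurable_bounded_integrable => //.
    by rewrite ltey_eq fin_num_measure.
  exists B; split; first exact: num_real.
  by move=> x Bx w _ /=; rewrite (le_trans (XB w))// ltW.
have mX : measurable_fun setT X by [].
rewrite -(integral_quadratic X v 1 t)//.
have mq : measurable_fun setT (fun w => (1 + t * X w + t ^+ 2 * expR (- (t * B)) / 2 * X w ^+ 2)).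
  apply: measurable_funD; first apply: measurable_funD => //.
    exact: measurable_funM.
  by apply: measurable_funM => //; exact: measurable_funX.
have iq : P.-integrable setT (fun w => (1 + t * X w + t ^+ 2 * expR (- (t * B)) / 2 * X w ^+ 2)%:E).
  apply: (@le_integrable _ _ _ _ _ measurableT _ (fun w => (1 + t * B + t ^+ 2 * expR (- (t * B)) / 2 * B ^+ 2)%:E)).
  - exact/measurable_EFinP.
  - move=> w _ /=; rewrite lee_fin [leRHS]ger0_norm; last first.
      by rewrite !addr_ge0 ?mulr_ge0 ?sqr_ge0 ?expR_ge0.
    rewrite (le_trans (ler_normD _ _))// lerD//.
      rewrite (le_trans (ler_normD _ _))// normr1 lerD2l normrM (ger0_norm t0).
      by rewrite ler_wpM2l.
    rewrite normrM ger0_norm ?divr_ge0 ?mulr_ge0 ?sqr_ge0 ?expR_ge0//.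
    rewrite ler_wpM2l// ?divr_ge0 ?mulr_ge0 ?sqr_ge0 ?expR_ge0// normrX.
    by rewrite lerXn2r ?nnegrE.
  - exact: finite_measure_integrable_cst.
have iexp : P.-integrable setT (fun w => (expR (t * X w))%:E).
  apply: (@le_integrable _ _ _ _ _ measurableT _ (fun w => (expR (t * B))%:E)).
  - apply/measurable_EFinP; apply: measurableT_comp => //; exact: measurable_funM.
  - move=> w _ /=; rewrite lee_fin !ger0_norm ?expR_ge0// ler_expR ler_wpM2l//.
    by rewrite (le_trans (ler_norm _)).
  - exact: finite_measure_integrable_cst.
apply: le_integral => // w _; rewrite lee_fin.
have tX : `|t * X w| <= t * B by rewrite normrM (ger0_norm t0) ler_wpM2l.
apply: le_trans (expR_ge_taylor2 _ _ tX).
by rewrite lerD2l le_eqVlt; apply/orP; left; apply/eqP; field.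
Qed.

(* When [x] and [y] lie on either side of the mean of the law tilted by [t0], the
   first two terms are small: the mass of [expR (t0 * S)] sits on [x <= S <= y]. *)
Lemma mgf_le_tail (S : T -> R) (t1 t0 t2 x y : R) :
  measurable_fun setT S -> 0 <= t0 -> t1 <= t0 <= t2 ->
  (\int[P]_w (expR (t0 * S w))%:E <=
    (expR ((t0 - t1) * x))%:E * \int[P]_w (expR (t1 * S w))%:E +
    (expR (- ((t2 - t0) * y)))%:E * \int[P]_w (expR (t2 * S w))%:E +
    (expR (t0 * y))%:E * P [set w | (x <= S w)%R])%E.
Proof.
move=> mS t00 /andP[t10 t02].
pose A := [set w | x <= S w].
have mA : measurable A.
  have := mS measurableT `[x, +oo[%classic (measurable_itv _).
  rewrite setTI; congr measurable.
  by apply/funext => w /=; rewrite in_itv/= andbT.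
have me t : measurable_fun setT (fun w => expR (t * S w)).
  by apply: measurableT_comp => //; exact: measurable_funM.
have e0 (t z : R) : (0 <= (expR t * expR z)%:E)%E by rewrite lee_fin mulr_ge0 ?expR_ge0.
have -> : (P [set w | (x <= S w)%R] = \int[P]_w (\1_A w)%:E)%E.
  by rewrite integral_indic// setIT.
have mI : measurable_fun setT (\1_A : T -> R) by exact: measurable_indic.
rewrite -!ge0_integralZl_EFin ?expR_ge0//; try (by move=> w _; rewrite lee_fin ?expR_ge0); try exact/measurable_EFinP.
rewrite -!ge0_integralD//.
all: try (by move=> w _; rewrite -?EFinD -?EFinM lee_fin ?addr_ge0 ?mulr_ge0 ?expR_ge0).
all: try (by apply/measurable_EFinP; apply: measurable_funM).
  apply: ge0_le_integral => //.
  - exact/measurable_EFinP.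
  - by apply/measurable_EFinP; apply: measurable_funD; [apply: measurable_funD|]; apply: measurable_funM.
  move=> w _; rewrite -!EFinM -!EFinD lee_fin.
  have p1 : 0 <= expR ((t0 - t1) * x) * expR (t1 * S w) by rewrite mulr_ge0 ?expR_ge0.
  have p2 : 0 <= expR (- ((t2 - t0) * y)) * expR (t2 * S w) by rewrite mulr_ge0 ?expR_ge0.
  have p3 : 0 <= expR (t0 * y) * \1_A w by rewrite mulr_ge0 ?expR_ge0.
  (* On each of the ranges [S w < x], [x <= S w <= y] and [y < S w], one of the three nonnegative
     terms dominates by itself. *)
  have [Sx|xS] := ltP (S w) x.
    suff : expR (t0 * S w) <= expR ((t0 - t1) * x) * expR (t1 * S w) by lra.
    rewrite -expRD ler_expR.
    have : 0 <= (t0 - t1) * (x - S w) by rewrite mulr_ge0 ?subr_ge0// ltW.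
    lra.
  have [Sy|yS] := leP (S w) y.
    suff : expR (t0 * S w) <= expR (t0 * y) * \1_A w by lra.
    by rewrite indicE mem_set// mulr1 ler_expR ler_wpM2l.
  suff : expR (t0 * S w) <= expR (- ((t2 - t0) * y)) * expR (t2 * S w) by lra.
  rewrite -expRD ler_expR.
  have : 0 <= (t2 - t0) * (S w - y) by rewrite mulr_ge0 ?subr_ge0// ltW.
  lra.
by apply/measurable_EFinP; apply: measurable_funD; apply: measurable_funM.
Qed.

End family.
End deviation.

(** * Moderate deviations of sums of independent variables *)

Section small.
Context {R : realType}.

(** The bound [x ^+ 2 / 2 <= expR x] beats [Num.sqrt (2 * L) <= 2 * L]. This will make the
    exponential parameter times the bound on a single variable negligible. *)
Lemma sqrt_expRN_small (u delta eta : R) : 0 <= u -> 0 < delta -> 0 < eta ->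
  exists2 L0 : R, 1 <= L0 & forall L, L0 <= L -> u * Num.sqrt (2 * L) * expR (- (delta * L)) <= eta.
Proof.
move=> u0 d0 e0; exists (1 + 4 * u / (delta ^+ 2 * eta)).
  by rewrite lerDl divr_ge0 ?mulr_ge0 ?sqr_ge0// ltW.
move=> L; set q := 4 * u / _ => qL.
have q0 : 0 <= q by rewrite /q divr_ge0 ?mulr_ge0 ?sqr_ge0// ltW.
have L1 : 1 <= L by lra.
have L0 : 0 < L by lra.
have dL : 0 <= delta * L by rewrite mulr_ge0// ltW.
have sqL : Num.sqrt (2 * L) <= 2 * L.
  rewrite -[leRHS]ger0_norm; last by lra.
  rewrite -sqrtr_sqr ler_wsqrtr// expr2 ler_peMl; lra.
have := @expR_ge1Dxn R (delta * L) 1 dL; rewrite (_ : 2`! = 2)%N// => h.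
have h2 : (delta * L) ^+ 2 / 2 <= expR (delta * L) by apply: le_trans h; rewrite lerDr.
have qE : q * (delta ^+ 2 * eta) = 4 * u.
  by rewrite /q divfK// gt_eqF// mulr_gt0// exprn_gt0.
rewrite expRN ler_pdivrMr ?expR_gt0//.
apply: (@le_trans _ _ (u * (2 * L))); first by rewrite ler_wpM2l.
apply: (@le_trans _ _ (eta * ((delta * L) ^+ 2 / 2))); last by rewrite ler_wpM2l// ltW.
have : q * (delta ^+ 2 * eta) * L <= L * (delta ^+ 2 * eta) * L.
  by rewrite ler_wpM2r ?(ltW L0)// ler_wpM2r ?mulr_ge0 ?sqr_ge0 ?(ltW e0)//; lra.
rewrite qE => h3; lra.
Qed.

End small.

Section probability_estimates.
Context {R : realType} {dT : measure_display} {T : measurableType dT}.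
Variable P : probability T R.
Context {I : choiceType}.
Variables (D : set I) (Y : I -> {RV P >-> R}).
Hypothesis indY : mutually_independent D Y.

Lemma probability_sum_le (alpha theta v p C c : R) :
  0 < alpha -> 0 < theta -> 0 <= v -> 0 <= C -> 0 < c -> v < c ^+ 2 * theta ->
  2 < p -> theta^-1 < alpha * (p / 2 - 1) ->
  (forall i, D i -> P.-integrable setT (EFin \o Y i)) ->
  (forall i, D i -> \int[P]_w (Y i w)%:E = 0)%E ->
  (forall i, D i -> \int[P]_w ((Y i w) ^+ 2)%:E = v%:E)%E ->
  (forall i, D i -> \int[P]_w (`|Y i w| `^ p)%:E <= C%:E)%E ->
  exists r K L0, [/\ theta^-1 < r, 0 <= K & forall (s : seq I) (L : R), uniq s ->
    (forall i, i \in s -> D i) -> L0 <= L -> (size s)%:R <= expR (alpha * L) ->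
    (P [set w | (c * Num.sqrt (2 * expR (alpha * L) * L) <= \sum_(i <- s) Y i w)%R]
       <= (K * expR (- (r * L)))%:E)%E].
Proof.
move=> a0 th0 v0 C0 c0 vc p2 thp iY Y0 Yv YC.
pose rho := v / (c ^+ 2 * theta).
have cth : 0 < c ^+ 2 * theta by rewrite mulr_gt0// exprn_gt0.
have rho0 : 0 <= rho by rewrite divr_ge0// ltW.
have rho1 : rho < 1 by rewrite ltr_pdivrMr// mul1r.
(* With [t = u * Num.sqrt (2 * L / A)], Chernoff's exponent is about [- (2 - rho) * L / theta], and
   [2 - rho > 1]. The minimizer [c / v] would make no sense for [v = 0]. *)
pose u := (c * theta)^-1.
have u0 : 0 < u by rewrite invr_gt0 mulr_gt0.
(* Chosen so that truncation at [A] to the power [1 / 2 - eps] leaves the tail exponent [r2] halfway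
   between [theta^-1] and [alpha * (p / 2 - 1)]. *)
pose eps := (alpha * (p / 2 - 1) - theta^-1) / (2 * alpha * p).
have p0 : 0 < p by lra.
have ap0 : 0 < 2 * alpha * p by rewrite !mulr_gt0.
have eps0 : 0 < eps by rewrite divr_gt0// subr_gt0.
(* A bound for [t * b] that ensures [rho * expR eta <= (1 + rho) / 2]; this leads to the exponent
   [r1], still above [theta^-1]. *)
pose eta := ln (1 + (1 - rho) / 2).
have eta0 : 0 < eta by apply: ln_gt0; lra.
have expeta : expR eta = 1 + (1 - rho) / 2 by rewrite lnK// posrE; lra.
have ae0 : 0 < alpha * eps by rewrite mulr_gt0.
have [L0 L01 small] := sqrt_expRN_small u (alpha * eps) eta (ltW u0) ae0 eta0.
pose r1 := (2 - (1 + rho) / 2) / theta.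
pose r2 := alpha * (p / 2 - 1) - alpha * p * eps.
have r2E : r2 = (alpha * (p / 2 - 1) + theta^-1) / 2.
  rewrite /r2 /eps; field; do ?[apply/andP; split]; by rewrite gt_eqF.
exists (Num.min r1 r2), (1 + C), L0; split; [|lra|].
  rewrite lt_min; apply/andP; split; last by rewrite r2E; lra.
  by rewrite /r1 -[ltLHS]mul1r ltr_pM2r ?invr_gt0//; lra.
move=> s L us sD L0L sM.
have L1 : 1 <= L by lra.
have Lp : 0 < L by lra.
set A := expR (alpha * L).
have A0 : 0 < A by exact: expR_gt0.
pose b := expR (alpha * (2^-1 - eps) * L).
pose t := u * Num.sqrt (2 * L / A).
have t0 : 0 <= t by rewrite mulr_ge0 ?sqrtr_ge0// ltW.
have b0 : 0 < b by exact: expR_gt0.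
have sA : Num.sqrt A = expR (alpha * L / 2).
  rewrite -[RHS]ger0_norm ?expR_ge0// -sqrtr_sqr expr2 -expRD; congr (Num.sqrt (expR _)); by field.
have sLA : Num.sqrt (2 * L / A) = Num.sqrt (2 * L) * expR (- (alpha * L / 2)).
  by rewrite sqrtrM ?mulr_ge0 ?(ltW Lp)// sqrtrV ?(ltW A0)// sA expRN.
have tb : t * b <= eta.
  apply: le_trans (small _ L0L).
  have -> : t * b = u * Num.sqrt (2 * L) * (expR (- (alpha * L / 2)) * b) by rewrite /t sLA; ring.
  rewrite ler_wpM2l ?mulr_ge0 ?sqrtr_ge0 ?(ltW u0)// -expRD ler_expR.
  by rewrite le_eqVlt; apply/orP; left; apply/eqP; field.
have tx : t * (c * Num.sqrt (2 * A * L)) = 2 * L / theta.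
  have -> : t * (c * Num.sqrt (2 * A * L)) = u * c * (Num.sqrt (2 * L / A) * Num.sqrt (2 * A * L)).
    by rewrite /t; ring.
  rewrite -sqrtrM; last by rewrite divr_ge0 ?mulr_ge0// ltW.
  have -> : 2 * L / A * (2 * A * L) = (2 * L) ^+ 2 by field; rewrite gt_eqF.
  rewrite sqrtr_sqr ger0_norm; last by lra.
  by rewrite /u; field; rewrite !gt_eqF.
have t2 : t ^+ 2 = u ^+ 2 * (2 * L / A).
  by rewrite /t exprMn sqr_sqrtr// ?divr_ge0 ?mulr_ge0// ltW.
have := fuk_nagaev P D Y indY v p C t b (c * Num.sqrt (2 * A * L)) s iY Y0 Yv YC (ltW p0) t0 b0 us sD.
move=> /le_trans; apply; rewrite lee_fin [leRHS]mulrDl mul1r lerD//.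
  apply: (@le_trans _ _ (expR (- (r1 * L)))); last first.
    by rewrite ler_expR lerN2 ler_pM2r// ge_min lexx.
  rewrite ler_expR tx.
  have h1 : (size s)%:R * (t ^+ 2 * expR (t * b) / 2 * v) <= A * (t ^+ 2 * expR eta / 2 * v).
    apply: ler_pM => //.
      by rewrite mulr_ge0// divr_ge0// mulr_ge0 ?expR_ge0//; exact: sqr_ge0.
    by rewrite ler_wpM2r// ler_wpM2r ?invr_ge0// ler_wpM2l ?sqr_ge0// ler_expR.
  have h2 : A * (t ^+ 2 * expR eta / 2 * v) = L / theta * (rho * expR eta).
    by rewrite t2 /u /rho; field; rewrite !gt_eqF.
  have h3 : L / theta * (rho * expR eta) <= L / theta * ((1 + rho) / 2).
    rewrite ler_wpM2l ?divr_ge0 ?(ltW Lp) ?(ltW th0)// expeta.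
    have : rho * (1 - rho) <= 1 - rho by rewrite ler_piMl//; lra.
    lra.
  have r1E : r1 * L = L / theta * (2 - (1 + rho) / 2) by rewrite /r1; ring.
  rewrite r1E; rewrite h2 in h1; lra.
have bp : b `^ p = expR (alpha * (2^-1 - eps) * L * p) by rewrite expRM.
apply: (@le_trans _ _ (A * (C * expR (- (alpha * (2^-1 - eps) * L * p))))).
  by rewrite bp -expRN ler_wpM2r// mulr_ge0// expR_ge0.
rewrite mulrCA ler_wpM2l// /A -expRD ler_expR.
apply: (@le_trans _ _ (- (r2 * L))).
  by rewrite /r2 le_eqVlt; apply/orP; left; apply/eqP; field.
by rewrite lerN2 ler_pM2r// ge_min lexx orbT.
Qed.

Lemma probability_sum_ge (alpha theta v B c : R) :
  0 < alpha -> 0 < theta -> 0 < v -> 0 < B -> 0 <= c -> c < Num.sqrt (v / theta) ->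
  (forall i w, D i -> `|Y i w| <= B) ->
  (forall i, D i -> \int[P]_w (Y i w)%:E = 0)%E ->
  (forall i, D i -> \int[P]_w ((Y i w) ^+ 2)%:E = v%:E)%E ->
  exists kappa L0, 0 < kappa /\ forall (s : seq I) (L : R), uniq s ->
    (forall i, i \in s -> D i) -> L0 <= L ->
    (1 - kappa) * expR (alpha * L) <= (size s)%:R <= expR (alpha * L) ->
    ((2^-1 * expR (- (L / theta)))%:E <=
     P [set w | (c * Num.sqrt (2 * expR (alpha * L) * L) <= \sum_(i <- s) Y i w)%R])%E.
Proof.
move=> a0 th0 v0 B0 c0 cv YB Y0 Yv.
pose q := Num.sqrt (v / theta).
pose h := (q - c) / (2 * v).
have h0 : 0 < h by rewrite divr_gt0 ?subr_gt0// mulr_gt0.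
have hE : q = c + 2 * h * v by rewrite /h; field; rewrite gt_eqF.
(* Tilting by [u * Num.sqrt (2 * L / A)] moves the mean of the sum to about
   [u * v * Num.sqrt (2 * A * L)]. Thus [um] and [up] correspond to the levels [c] and [q], and [u0]
   is their midpoint. *)
pose um := c / v; pose u0 := um + h; pose up := u0 + h.
have um0 : 0 <= um by rewrite divr_ge0// ltW.
have u00 : 0 < u0 by rewrite /u0; lra.
have up0 : 0 < up by rewrite /up; lra.
have upE : up ^+ 2 * v = theta^-1.
  have -> : up = q / v by rewrite hE /up /u0 /um; field; rewrite gt_eqF.
  rewrite exprMn sqr_sqrtr ?divr_ge0 ?ltW//; field; by rewrite !gt_eqF.
(* Convexity of [u ^+ 2 * v] gives a gain [h ^+ 2 * v = 4 * k0] at distance [h] from [u0]. Errors of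
   [k0] in the two generating functions compared leave [2 * k0]. *)
pose k0 := h ^+ 2 * v / 4.
have k00 : 0 < k0 by rewrite divr_gt0// mulr_gt0// exprn_gt0.
(* a relative error of 3 z in the exponent u^2 v L is at most k0 L for u <= up *)
pose z := h ^+ 2 / (12 * up ^+ 2).
have up20 : 0 < up ^+ 2 by rewrite exprn_gt0.
have z0 : 0 < z by apply: divr_gt0; [rewrite exprn_gt0|apply: mulr_gt0].
have zE : 3 * z * (up ^+ 2 * v) = k0 by rewrite /z /k0; field; rewrite gt_eqF.
have z1p : 0 < 1 + z by lra.
have z1 : z <= 12^-1.
  rewrite /z invfM mulrA mulrAC ler_piMl ?invr_ge0// ler_pdivrMr ?exprn_gt0// mul1r.
  by rewrite lerXn2r ?nnegrE ?ltW// /up; lra.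
have z1m : 0 <= 1 - z by lra.
pose eta := ln (1 + z).
have eta0 : 0 < eta by apply: ln_gt0; lra.
have expeta : expR eta = 1 + z by rewrite lnK// posrE; lra.
have a20 : 0 < alpha / 2 by lra.
(* Both bounds on [u * k] together make the second order term [y] of a single generating function at
   most [z]. *)
pose tau := Num.min 1 (2 * z / v).
have tau0 : 0 < tau by rewrite lt_min ltr01 /=; apply: divr_gt0 => //; apply: mulr_gt0.
have [L1 L11 small1] := sqrt_expRN_small (up * B) (alpha / 2) eta (mulr_ge0 (ltW up0) (ltW B0)) a20 eta0.
have [L2 L21 small2] := sqrt_expRN_small up (alpha / 2) tau (ltW up0) a20 tau0.
(* The tolerated relative deficit in the number of terms is again [z]. The last summand of the
   threshold gives [expR (- (2 * k0 * L)) <= 4^-1]. *)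
exists z, (L1 + L2 + 3 / (2 * k0)); split=> // s L us sD L0L /andP[sM1 sM2].
have L3 : 0 < 3 / (2 * k0) by apply: divr_gt0 => //; apply: mulr_gt0.
have LL1 : L1 <= L by lra.
have LL2 : L2 <= L by lra.
have Lp : 0 < L by lra.
have LL3 : 3 <= 2 * k0 * L.
  have : 3 / (2 * k0) <= L by lra.
  have k20 : 0 < 2 * k0 by apply: mulr_gt0.
  by rewrite ler_pdivrMr // mulrC.
set A := expR (alpha * L).
have A0 : 0 < A by exact: expR_gt0.
pose k := Num.sqrt (2 * L / A).
have k00' : 0 <= k by exact: sqrtr_ge0.
have sA : Num.sqrt A = expR (alpha * L / 2).
  rewrite -[RHS]ger0_norm ?expR_ge0// -sqrtr_sqr expr2 -expRD; congr (Num.sqrt (expR _)); by field.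
have kE : k = Num.sqrt (2 * L) * expR (- (alpha / 2 * L)).
  rewrite /k sqrtrM ?mulr_ge0 ?(ltW Lp)// sqrtrV ?(ltW A0)// sA expRN.
  by congr (_ * (expR _)^-1); field.
have k2 : k ^+ 2 = 2 * L / A by rewrite /k sqr_sqrtr// ?divr_ge0 ?mulr_ge0// ltW.
have kB : up * k * B <= eta.
  apply: le_trans (small1 _ LL1); rewrite kE le_eqVlt; apply/orP; left; apply/eqP; ring.
have kt : up * k <= tau.
  apply: le_trans (small2 _ LL2); rewrite kE le_eqVlt; apply/orP; left; apply/eqP; ring.
pose S w := \sum_(i <- s) Y i w.
have mY i : measurable_fun setT (Y i) by [].
have mS : measurable_fun setT S by exact: measurable_sum.
have prodE t : (\int[P]_w (expR (t * S w))%:E = \int[P]_w (\prod_(i <- s) expR (t * Y i w))%:E)%E.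
  by apply: eq_integral => w _; rewrite -expR_sum -mulr_sumr.
have mf t (i : I) : measurable_fun setT (fun y : R => expR (t * y)).
  by apply: measurableT_comp => //; exact: measurable_funM.
have mgf t : 0 <= t -> (\int[P]_w (expR (t * S w))%:E = \prod_(i <- s) \int[P]_w (expR (t * Y i w))%:E)%E.
  move=> t0; rewrite prodE.
  apply: (integral_prod_indep _ D Y indY (fun _ y => expR (t * y)) s (mf t)) => //.
  move=> i Di; apply: le_lt_trans (mgf_bounded_le _ (Y i) v t B _ _ _ t0 (ltW B0)) (ltry _).
  - by move=> w; exact: YB.
  - exact: Y0.
  - exact: Yv.
have mgf_le u : 0 <= u <= up ->
    (\int[P]_w (expR (u * k * S w))%:E <= (expR (L * (u ^+ 2 * v + k0)))%:E)%E.
  move=> /andP[uge ule]; have t0 : 0 <= u * k by rewrite mulr_ge0.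
  rewrite mgf//.
  pose m := expR ((u * k) ^+ 2 * expR (u * k * B) / 2 * v).
  apply: (@le_trans _ _ (m ^+ (size s))%:E).
    have -> : (m ^+ (size s))%:E = (\prod_(i <- s) m%:E)%E.
      by rewrite prodEFin big_const_seq count_predT iter_mulr_1.
    rewrite big_seq [leRHS]big_seq.
    have : ((0 <= \prod_(i <- s | i \in s) \int[P]_w (expR (u * k * Y i w))%:E) &&
      (\prod_(i <- s | i \in s) \int[P]_w (expR (u * k * Y i w))%:E
        <= \prod_(i <- s | i \in s) m%:E))%E.
      elim/big_ind2 : _ => //.
      - by rewrite lee01 lexx.
      - move=> x1 x2 y1 y2 /andP[x10 x12] /andP[y10 y12].
        by rewrite mule_ge0//= lee_pmul.
      - move=> i /sD Di; apply/andP; split.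
          by apply: integral_ge0 => w _; rewrite lee_fin expR_ge0.
        apply: mgf_bounded_le => //; [by move=> w; exact: YB|exact: Y0|exact: Yv|exact: ltW].
    by move=> /andP[].
  rewrite lee_fin /m -expRM_natl ler_expR.
  have uB : expR (u * k * B) <= 1 + z.
    rewrite -expeta ler_expR (le_trans _ kB)// ler_wpM2r ?(ltW B0)// ler_wpM2r//.
  apply: (@le_trans _ _ (A * ((u * k) ^+ 2 * (1 + z) / 2 * v))).
    apply: ler_pM => //.
      by rewrite mulr_ge0 ?(ltW v0)// ?divr_ge0 ?mulr_ge0 ?sqr_ge0 ?expR_ge0.
    by rewrite ler_wpM2r ?(ltW v0)// ler_wpM2r ?invr_ge0// ler_wpM2l ?sqr_ge0.
  rewrite exprMn k2.
  have -> : A * (u ^+ 2 * (2 * L / A) * (1 + z) / 2 * v) = L * (u ^+ 2 * v + z * (u ^+ 2 * v)).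
    by field; rewrite gt_eqF.
  rewrite ler_wpM2l ?(ltW Lp)// lerD2l.
  have : z * (u ^+ 2 * v) <= z * (up ^+ 2 * v).
    rewrite ler_wpM2l ?(ltW z0)// ler_wpM2r ?(ltW v0)// lerXn2r ?nnegrE// ltW//.
  lra.
have mgf_ge u : 0 <= u <= up ->
    ((expR (L * (u ^+ 2 * v - k0)))%:E <= \int[P]_w (expR (u * k * S w))%:E)%E.
  move=> /andP[uge ule]; have t0 : 0 <= u * k by rewrite mulr_ge0.
  rewrite mgf//.
  pose y := (u * k) ^+ 2 * expR (- (u * k * B)) / 2 * v.
  have y0 : 0 <= y.
    by rewrite mulr_ge0 ?(ltW v0)// ?divr_ge0 ?mulr_ge0 ?sqr_ge0 ?expR_ge0.
  apply: (@le_trans _ _ ((1 + y) ^+ (size s))%:E); last first.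
    have -> : ((1 + y) ^+ (size s))%:E = (\prod_(i <- s) (1 + y)%:E)%E.
      by rewrite prodEFin big_const_seq count_predT iter_mulr_1.
    rewrite big_seq [leRHS]big_seq.
    have : ((0 <= \prod_(i <- s | i \in s) (1 + y)%:E) &&
      (\prod_(i <- s | i \in s) (1 + y)%:E
        <= \prod_(i <- s | i \in s) \int[P]_w (expR (u * k * Y i w))%:E))%E.
      elim/big_ind2 : _ => //.
      - by rewrite lee01 lexx.
      - move=> x1 x2 y1 y2 /andP[x10 x12] /andP[y10 y12].
        by rewrite mule_ge0//= lee_pmul.
      - move=> i /sD Di; apply/andP; split; first by rewrite lee_fin addr_ge0.
        apply: mgf_bounded_ge => //; [by move=> w; exact: YB|exact: Y0|exact: Yv|exact: ltW|exact: ltW].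
    by move=> /andP[].
  rewrite lee_fin.
  apply: (@le_trans _ _ (expR (y / (1 + y)) ^+ size s)); last first.
    by rewrite lerXn2r ?nnegrE ?expR_ge0 ?addr_ge0// expR_div1D_le.
  rewrite -expRM_natl ler_expR.
  have ut : u * k <= tau by rewrite (le_trans _ kt)// ler_wpM2r.
  have ut1 : u * k <= 1 by rewrite (le_trans ut)// ge_min lexx.
  have utz : u * k * v <= 2 * z.
    by rewrite -ler_pdivlMr// (le_trans ut)// ge_min lexx orbT.
  have uB : expR (u * k * B) <= 1 + z.
    rewrite -expeta ler_expR (le_trans _ kB)// ler_wpM2r ?(ltW B0)// ler_wpM2r//.
  have uBN : (1 + z)^-1 <= expR (- (u * k * B)).
    by rewrite expRN lef_pV2 ?posrE ?expR_gt0//.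
  have uBN1 : expR (- (u * k * B)) <= 1 by rewrite expR_le1 oppr_le0 mulr_ge0 ?(ltW B0).
  have yz : y <= z.
    apply: (@le_trans _ _ ((u * k) * (u * k * v) / 2)).
      have -> : u * k * (u * k * v) / 2 = (u * k) ^+ 2 * 1 / 2 * v by ring.
      by rewrite ler_wpM2r ?(ltW v0)// ler_wpM2r ?invr_ge0// ler_wpM2l ?sqr_ge0.
    have : u * k * (u * k * v) <= u * k * v by rewrite ler_piMl// mulr_ge0 ?(ltW v0).
    lra.
  have step1 : (1 - z) * A * (y / (1 + z)) <= (size s)%:R * (y / (1 + y)).
    apply: ler_pM => //.
    - by rewrite mulr_ge0 ?(ltW A0).
    - by rewrite divr_ge0// ltW.
    - by rewrite ler_wpM2l// lef_pV2 ?posrE ?lerD2l// ltr_wpDr.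
  apply: le_trans step1.
  have yge : (u * k) ^+ 2 * (1 + z)^-1 / 2 * v <= y.
    by rewrite ler_wpM2r ?(ltW v0)// ler_wpM2r ?invr_ge0// ler_wpM2l ?sqr_ge0.
  have step2 : (1 - z) * A * ((u * k) ^+ 2 * (1 + z)^-1 / 2 * v / (1 + z)) <= (1 - z) * A * (y / (1 + z)).
    rewrite ler_wpM2l ?mulr_ge0 ?(ltW A0)//.
    by rewrite ler_wpM2r// invr_ge0 ltW.
  apply: le_trans step2.
  have zn : 1 + z != 0 by rewrite gt_eqF.
  have -> : (1 - z) * A * ((u * k) ^+ 2 * (1 + z)^-1 / 2 * v / (1 + z)) =
     L * (u ^+ 2 * v) * ((1 - z) / (1 + z) ^+ 2).
    by rewrite exprMn k2; field; rewrite zn gt_eqF.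
  (* The losses are a factor [1 - z] from the number of terms, and a factor [(1 + z)^-1] from each
     of [expR (- (u * k * B))] and [(1 + y)^-1]. *)
  have zz : 1 - 3 * z <= (1 - z) / (1 + z) ^+ 2.
    rewrite ler_pdivlMr ?exprn_gt0//.
    have : 0 <= z ^+ 2 by exact: sqr_ge0.
    have : 0 <= z ^+ 2 * z by rewrite mulr_ge0 ?sqr_ge0// ltW.
    lra.
  apply: (@le_trans _ _ (L * (u ^+ 2 * v) * (1 - 3 * z))); last first.
    by rewrite ler_wpM2l// mulr_ge0 ?(ltW Lp)// mulr_ge0 ?sqr_ge0// ltW.
  rewrite -mulrA ler_wpM2l ?(ltW Lp)//.
  have : z * (u ^+ 2 * v) <= z * (up ^+ 2 * v).
    rewrite ler_wpM2l ?(ltW z0)// ler_wpM2r ?(ltW v0)// lerXn2r ?nnegrE// ltW//.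
  lra.
pose x := c * Num.sqrt (2 * A * L).
have kx : k * x = 2 * c * L.
  rewrite /x mulrCA /k -sqrtrM; last by rewrite divr_ge0 ?mulr_ge0// ltW.
  have -> : 2 * L / A * (2 * A * L) = (2 * L) ^+ 2 by field; rewrite gt_eqF.
  rewrite sqrtr_sqr ger0_norm; [ring|lra].
have kp : 0 < k by rewrite /k sqrtr_gt0 divr_gt0// mulr_gt0.
(* Since [w2 = 2 * up * v], the upper cutoff [y] is at the level [q], just as the lower cutoff [x]
   is at the level [c]. *)
pose w2 := 2 * u0 * v + 2 * h * v.
pose y := w2 * L / k.
have ky : k * y = w2 * L by rewrite /y; field; rewrite gt_eqF.
have t00 : 0 <= u0 * k by rewrite mulr_ge0// ltW.
have t12 : um * k <= u0 * k <= up * k by apply/andP; split; rewrite ler_pM2r// /up /u0; lra.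
have u0p : 0 <= u0 <= up by apply/andP; split; [exact: ltW|rewrite /up; lra].
have := mgf_le_tail P S (um * k) (u0 * k) (up * k) x y mS t00 t12.
move=> /(le_trans (mgf_ge u0 u0p)); rewrite -/S -/x.
pose p := P [set w | x <= S w]; rewrite -[P _]/p => tail.
have {tail} tail : ((expR (L * (u0 ^+ 2 * v - k0)))%:E <=
   (expR (2 * h * c * L))%:E * (expR (L * (um ^+ 2 * v + k0)))%:E +
   (expR (- (h * w2 * L)))%:E * (expR (L * (up ^+ 2 * v + k0)))%:E +
   (expR (u0 * w2 * L))%:E * p)%E.
  have e1 : (u0 * k - um * k) * x = 2 * h * c * L by transitivity ((u0 - um) * (k * x)); [ring|rewrite kx /u0; ring].
  have e2 : (up * k - u0 * k) * y = h * w2 * L by transitivity ((up - u0) * (k * y)); [ring|rewrite ky /up; ring].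
  have e3 : u0 * k * y = u0 * w2 * L by transitivity (u0 * (k * y)); [ring|rewrite ky; ring].
  rewrite e1 e2 e3 in tail.
  apply: (le_trans tail).
  rewrite leeD// leeD// lee_pmul2l ?lte_fin ?expR_gt0//; apply: mgf_le.
  - by rewrite um0 /up /u0; lra.
  - by rewrite lexx ltW.
have pE : p = (fine p)%:E.
  rewrite fineK// fin_num_measure//.
  have := mS measurableT `[x, +oo[%classic (measurable_itv _).
  rewrite setTI; congr measurable.
  by apply/funext => w /=; rewrite in_itv/= andbT.
move: tail; rewrite pE -!EFinM -!EFinD !lee_fin -!expRD.
pose Q := expR (L * (u0 ^+ 2 * v - k0)).
have Q0 : 0 < Q by exact: expR_gt0.
have vn : v != 0 by rewrite gt_eqF.
have cE : c = um * v by rewrite /um divfK.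
(* Completing the square: [2 * h * um + um ^+ 2 = u0 ^+ 2 - h ^+ 2], and [h ^+ 2 * v = 4 * k0]. The
   term with [up] is treated in the same way. *)
have -> : expR (2 * h * c * L + L * (um ^+ 2 * v + k0)) = Q * expR (- (2 * k0 * L)).
  rewrite -expRD; congr expR; rewrite cE /u0 /k0; by field.
have -> : expR (- (h * w2 * L) + L * (up ^+ 2 * v + k0)) = Q * expR (- (2 * k0 * L)).
  rewrite -expRD; congr expR; rewrite /w2 /up /k0; by field.
rewrite -/Q => tail.
clear mgf_ge mgf_le small1 small2 mgf.
have e4 : expR (- (2 * k0 * L)) <= 4^-1.
  rewrite expRN lef_pV2 ?posrE ?expR_gt0//.
  by apply: le_trans (expR_ge1Dx _); lra.
have : Q * expR (- (2 * k0 * L)) <= Q / 4 by rewrite ler_wpM2l// ltW.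
move=> Qs; have : Q / 2 <= expR (u0 * w2 * L) * fine p by lra.
rewrite -(ler_pM2l (expR_gt0 (u0 * w2 * L))); apply: le_trans.
rewrite mulrCA [leRHS]mulrC ler_wpM2l// -expRD ler_expR -upE.
have hL : 0 <= h ^+ 2 * v * L by apply: mulr_ge0; [apply: mulr_ge0; [exact: sqr_ge0|exact: ltW]|exact: ltW].
have -> : L * (u0 ^+ 2 * v - k0) =
    u0 * w2 * L - L * (up ^+ 2 * v) + 3 / 4 * (h ^+ 2 * v * L).
  by rewrite /w2 /k0 /up; field.
lra.
Qed.

End probability_estimates.

(** * Borel-Cantelli lemmas on a lattice *)

Section series.
Context {R : realType}.

(** It follows from [ln x - ln (x + 1) <= - (x + 1)^-1] and [1 + s <= expR s]. The right side
    telescopes, which bounds tails of the series without integrals. *)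
Lemma powRN_telescope (delta x : R) : 0 < delta -> 0 < x ->
  delta * (x + 1) `^ (- (1 + delta)) <= x `^ (- delta) - (x + 1) `^ (- delta).
Proof.
move=> d0 x0; have x1 : 0 < x + 1 by lra.
have xn : x + 1 != 0 by rewrite gt_eqF.
have lnle : ln x - ln (x + 1) <= - (x + 1)^-1.
  rewrite -ln_div ?posrE//.
  have -> : x / (x + 1) = 1 + - (x + 1)^-1 by field.
  apply: le_ln1Dx; rewrite ltrN2 invf_lt1//; lra.
have -> : (x + 1) `^ (- (1 + delta)) = (x + 1)^-1 * (x + 1) `^ (- delta).
  rewrite -powR_inv1 ?(ltW x1)// -powRD; last by rewrite xn implybT.
  congr (_ `^ _); ring.
have -> : x `^ (- delta) = (x + 1) `^ (- delta) * expR (- delta * (ln x - ln (x + 1))).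
  rewrite /powR (gt_eqF x0) (negbTE xn) -expRD; congr expR; ring.
have p0 : 0 < (x + 1) `^ (- delta) by exact: powR_gt0.
have := expR_ge1Dx (- delta * (ln x - ln (x + 1))).
have : delta * (x + 1)^-1 <= - delta * (ln x - ln (x + 1)).
  by rewrite mulNr -mulrN ler_wpM2l ?(ltW d0)// lerNr.
move=> h1 h2.
rewrite -[X in _ - X]mulr1 -mulrBr mulrA mulrC ler_wpM2l ?(ltW p0)//; lra.
Qed.

Lemma powRN_series_tail (rho eps : R) (N0 : nat) : 1 < rho -> 0 < eps ->
  exists2 N, (N0 <= N)%N & forall K : nat, \sum_(j < K) ((N + j)%:R : R) `^ (- rho) <= eps.
Proof.
move=> rho1 e0; pose delta := rho - 1.
have d0 : 0 < delta by rewrite /delta; lra.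
have de0 : 0 < delta * eps by exact: mulr_gt0.
pose x : R := (delta * eps)^-1 `^ delta^-1.
pose M := (Num.truncn x + N0).+1.
(* The sum starts one step after [M], because each term is bounded by a difference that begins at
   the preceding integer. *)
exists M.+1; first by rewrite /M; lia.
have xM : x <= M%:R.
  apply: ltW; apply: lt_le_trans (truncnS_gt x) _.
  by rewrite ler_nat /M ltnS leq_addr.
have M0 : 0 < (M%:R : R) by rewrite ltr0n.
have Md : (M%:R : R) `^ (- delta) <= delta * eps.
  rewrite powRN -[leRHS]invrK lef_pV2 ?posrE ?invr_gt0 ?powR_gt0//.
  have -> : (delta * eps)^-1 = x `^ delta.
    by rewrite /x -powRrM mulVf ?gt_eqF// powRr1// invr_ge0 ltW.
  by apply: ge0_ler_powR => //; rewrite ?nnegrE ?powR_ge0// ?ltW.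
move=> K.
suff : delta * \sum_(j < K) ((M.+1 + j)%:R : R) `^ (- rho)
    <= (M%:R : R) `^ (- delta) - ((M + K)%:R : R) `^ (- delta).
  move=> h; rewrite -(ler_pM2l d0); apply: le_trans h _.
  by rewrite lerBlDr (le_trans Md)// lerDl powR_ge0.
elim: K => [|K IH]; first by rewrite big_ord0 mulr0 addn0 subrr.
rewrite big_ord_recr/= mulrDr.
have MK0 : 0 < ((M + K)%:R : R) by rewrite ltr0n.
have := powRN_telescope delta (M + K)%:R d0 MK0.
have -> : ((M + K)%:R + 1 : R) = (M.+1 + K)%:R by rewrite natr1 addSn.
have -> : - (1 + delta) = - rho by rewrite /delta; ring.
rewrite addnS -addSn => h; lra.
Qed.

(** Comparison with the logarithm, whose increments are [ln (1 + m^-1) <= m^-1]. *)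
Lemma harmonic_series_ge (N : nat) (x : R) : (0 < N)%N ->
  exists K : nat, x <= \sum_(j < K) ((N + j)%:R : R)^-1.
Proof.
move=> N0; have Np : 0 < (N%:R : R) by rewrite ltr0n.
have lnle K : ln ((N + K)%:R : R) - ln N%:R <= \sum_(j < K) ((N + j)%:R : R)^-1.
  elim: K => [|K IH]; first by rewrite big_ord0 addn0 subrr.
  rewrite big_ord_recr/=.
  have NK0 : 0 < ((N + K)%:R : R) by rewrite ltr0n; lia.
  have : ln ((N + K.+1)%:R : R) - ln (N + K)%:R <= (N + K)%:R^-1.
    rewrite -ln_div ?posrE ?ltr0n//; try lia.
    have -> : (N + K.+1)%:R / (N + K)%:R = 1 + (N + K)%:R^-1 :> R.
      by rewrite addnS -natr1 mulrDl divff ?gt_eqF// mul1r.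
    by apply: le_ln1Dx; rewrite (lt_trans (ltrN10 _))// invr_gt0.
  lra.
pose K := (Num.truncn (expR (x + ln (N%:R : R)))).+1.
exists K; apply: le_trans (lnle K).
rewrite lerBrDr -ler_expR lnK ?posrE ?ltr0n//; last by rewrite /K; lia.
apply: ltW; apply: lt_le_trans (truncnS_gt _) _.
by rewrite ler_nat leq_addl.
Qed.

End series.

Section borel_cantelli_lattice.
Context {R : realType} {dT : measure_display} {T : measurableType dT}.
Variable P : probability T R.
Variable d : nat.
Hypothesis d0 : (0 < d)%N.
Variable E : {ffun 'I_d -> nat} -> set T.
Hypothesis mE : forall i, measurable (E i).

(** Enumerates the cube of side [[N, N + K)] by a finite type, so that sums of coordinatewise
    products over the cube become [d]-th powers. *)
Definition shift_index (N K : nat) (t : {ffun 'I_d -> 'I_K}) : {ffun 'I_d -> nat} :=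
  [ffun k => (N + t k)%N].

Lemma shift_indexP (N K : nat) (i : {ffun 'I_d -> nat}) :
  (forall k, N <= i k < N + K)%N -> exists t : {ffun 'I_d -> 'I_K}, i = shift_index N K t.
Proof.
move=> iNK.
have h k : (i k - N < K)%N by have := iNK k; lia.
exists [ffun k => Ordinal (h k)]; apply/ffunP => k; rewrite !ffunE/=.
by have := iNK k; lia.
Qed.

Lemma sum_prod_shift (N K : nat) (F : nat -> R) :
  \sum_(t : {ffun 'I_d -> 'I_K}) \prod_(k < d) F (shift_index N K t k)
    = (\sum_(j < K) F (N + j)%N) ^+ d.
Proof.
rewrite -[in RHS](card_ord d) -prodr_const.
rewrite (bigA_distr_bigA (fun _ (j : 'I_K) => F (N + j)%N)).
by apply: eq_bigr => t _; apply: eq_bigr => k _; rewrite ffunE.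
Qed.

Lemma negligible_le_eps (A : set T) :
  (forall eps : R, 0 < eps -> exists B, [/\ measurable B, A `<=` B & (P B <= eps%:E)%E]) ->
  P.-negligible A.
Proof.
move=> h.
have hn n : {B : set T | [/\ measurable B, A `<=` B & (P B <= (n.+1%:R^-1)%:E)%E]}.
  by apply: cid; apply: h; rewrite invr_gt0.
pose B n := sval (hn n).
have mB : measurable (\bigcap_n B n).
  by apply: bigcapT_measurable => n; have [] := svalP (hn n).
exists (\bigcap_n B n); split => //.
- apply/eqP; rewrite eq_le measure_ge0 andbT; apply/lee_addgt0Pr => e e0; rewrite add0e.
  apply: (@le_trans _ _ ((Num.truncn e^-1).+1%:R^-1)%:E).
    have [mBn _ +] := svalP (hn (Num.truncn e^-1)); apply: le_trans.
    by apply: le_measure; rewrite ?inE//; exact: bigcap_inf.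
  rewrite lee_fin -[leRHS]invrK lef_pV2 ?posrE ?invr_gt0//.
  exact/ltW/truncnS_gt.
- by move=> w Aw n _; have [_ + _] := svalP (hn n); apply.
Qed.

(** Beyond a large [N], the union [U K] of the events in a cube has probability at most [C] times
    the [d]-th power of a tail of a convergent series. Continuity from below extends this to all
    indices beyond [N]. *)
Lemma borel_cantelli_lattice1 (rho C : R) (N0 : nat) : 1 < rho -> 0 <= C ->
  (forall i : {ffun 'I_d -> nat}, (forall k, N0 <= i k)%N ->
     (P (E i) <= (C * \prod_(k < d) (i k)%:R `^ (- rho))%:E)%E) ->
  {ae P, forall w, exists N, forall i : {ffun 'I_d -> nat}, (forall k, N <= i k)%N -> ~ E i w}.
Proof.
move=> rho1 C0 PE.
apply: negligible_le_eps => eps e0.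
(* The bound 1 gives [x ^+ d <= x] for the tail sum [x]; the denominator is [C + 1] because [C] may
   be 0. *)
pose eps' := Num.min 1 (eps / (C + 1)).
have e'0 : 0 < eps' by rewrite lt_min ltr01/= divr_gt0//; lra.
have [N N0N tail] := powRN_series_tail rho eps' N0 rho1 e'0.
pose U K := [set w | exists2 i : {ffun 'I_d -> nat}, (forall k, N <= i k < N + K)%N & E i w].
have UE K : U K = \big[setU/set0]_(t : {ffun 'I_d -> 'I_K}) E (shift_index N K t).
  rewrite -bigcup_seq; apply/seteqP; split => w.
    move=> [i /shift_indexP[t ->] Ew]; exists t => //=.
    by rewrite mem_index_enum.
  move=> [t _ Ew]; exists (shift_index N K t) => // k.
  by rewrite ffunE leq_addr ltn_add2l ltn_ord.
have mU K : measurable (U K) by rewrite UE; exact: bigsetU_measurable.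
have PU K : (P (U K) <= eps%:E)%E.
  rewrite UE.
  apply: (le_trans (measure_bigsetU_seq_le P _ _ _)) => //.
  apply: (@le_trans _ _ (\sum_(t : {ffun 'I_d -> 'I_K})
     (C * \prod_(k < d) (shift_index N K t k)%:R `^ (- rho))%:E)%E).
    apply: lee_sum => t _; apply: PE => k; rewrite ffunE; lia.
  rewrite sumEFin lee_fin -mulr_sumr.
  rewrite (sum_prod_shift N K (fun m => m%:R `^ (- rho))).
  set x := \sum_(j < K) _.
  have x0 : 0 <= x by apply: sumr_ge0 => j _; exact: powR_ge0.
  have xe : x <= eps' by exact: tail.
  have xe1 : x <= 1 by rewrite (le_trans xe)// ge_min lexx.
  have xd : x ^+ d <= x by rewrite -[leRHS]expr1 ler_wiXn2l.
  apply: (@le_trans _ _ (C * eps')); first by rewrite ler_wpM2l// (le_trans xd).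
  apply: (@le_trans _ _ (C * (eps / (C + 1)))).
    by rewrite ler_wpM2l// ge_min lexx orbT.
  rewrite mulrCA ler_piMr ?(ltW e0)// ler_pdivrMr; lra.
exists (\bigcup_K U K); split.
- exact: bigcupT_measurable.
- move=> w; apply: contra_notP => nU; exists N => i iN Ei; apply: nU.
  exists (\max_(k < d) i k).+1 => //=; exists i => // k.
  by rewrite iN /= (leq_ltn_trans (leq_bigmax k))// addnS ltnS leq_addl.
- have ndU : nondecreasing_seq U.
    move=> a b ab; apply/subsetPset => w [i h Ew]; exists i => // k.
    by have := h k; lia.
  have cvgU : P (U K) @[K --> \oo] --> P (\bigcup_K U K).
    by apply: nondecreasing_cvg_mu => //; exact: bigcupT_measurable.
  rewrite -(cvg_lim _ cvgU)//; apply: lime_le; last exact: nearW.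
  by apply/cvg_ex; eexists; exact: cvgU.
Qed.

(** By independence and [1 - s <= expR (- s)], a far cube contains no event that occurs with
    probability at most [expR (- (C * x ^+ d))], where [x] is a section of the harmonic series and
    can be made large. *)
Lemma borel_cantelli_lattice2 (C : R) (N0 : nat) : 0 < C ->
  (forall (J : seq {ffun 'I_d -> nat}), uniq J -> (forall (i : {ffun 'I_d -> nat}) k, i \in J -> (0 < i k)%N) ->
    P (\big[setI/setT]_(i <- J) ~` E i) = (\prod_(i <- J) P (~` E i))%E) ->
  (forall i : {ffun 'I_d -> nat}, (forall k, N0 <= i k)%N ->
     ((C * \prod_(k < d) (i k)%:R^-1)%:E <= P (E i))%E) ->
  {ae P, forall w, forall N, exists2 i : {ffun 'I_d -> nat}, (forall k, N <= i k)%N & E i w}.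
Proof.
move=> C0 indE PE.
apply/ae_foralln => N1.
apply: negligible_le_eps => eps e0.
(* The successor keeps all coordinates positive, as the independence hypothesis requires. *)
pose N := (N0 + N1).+1.
(* A sum [x >= 1] satisfies [x <= x ^+ d], and the second bound gives [- ln eps <= C * x]. *)
have [K hK] := harmonic_series_ge N (Num.max 1 (- ln eps / C)) (ltn0Sn _).
exists (\big[setI/setT]_(t : {ffun 'I_d -> 'I_K}) ~` E (shift_index N K t)).
have injs : injective (shift_index N K).
  move=> s t /ffunP st; apply/ffunP => k; have := st k; rewrite !ffunE => h.
  by apply: val_inj => /=; lia.
split.
- by apply: bigsetI_measurable => t _; exact: measurableC.
- move=> w /= nE; rewrite -bigcap_seq => t _ /= Et; apply: nE.
  exists (shift_index N K t) => // k; rewrite ffunE /N; lia.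
rewrite -(big_map (shift_index N K) predT (fun i => ~` E i)).
rewrite indE; last 2 first.
- by rewrite map_inj_uniq// index_enum_uniq.
- by move=> i k /mapP[t _ ->]; rewrite ffunE.
rewrite big_map.
have PC t : P (~` E t) = (1 - fine (P (E t)))%:E.
  by rewrite probability_setC// EFinB fineK// fin_num_measure.
have PE1 t : fine (P (E t)) <= 1.
  by rewrite -lee_fin fineK ?fin_num_measure// probability_le1.
under eq_bigr do rewrite PC.
rewrite prodEFin lee_fin.
apply: (@le_trans _ _ (\prod_(t : {ffun 'I_d -> 'I_K})
   expR (- (C * \prod_(k < d) (shift_index N K t k)%:R^-1)))).
  apply: ler_prod => t _; rewrite subr_ge0 PE1/=.
  apply: (le_trans (expR_ge1Dx _)); rewrite ler_expR lerN2 -lee_fin fineK ?fin_num_measure//.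
  apply: PE => k; rewrite ffunE /N; lia.
rewrite -expR_sum sumrN -mulr_sumr (sum_prod_shift N K (fun m => m%:R^-1)).
move: hK; set x := \sum_(j < K) _; rewrite ge_max => /andP[x1 xe].
have xd : x <= x ^+ d by rewrite -[leLHS]expr1 ler_weXn2l.
rewrite -[leRHS]lnK ?posrE// ler_expR lerNl.
have : C * x <= C * x ^+ d by rewrite ler_wpM2l// ltW.
apply: le_trans; by rewrite mulrC -ler_pdivrMr.
Qed.

End borel_cantelli_lattice.

(** * Boxes at lattice points *)

Section boxes.
Variable d : nat.
Implicit Types n k x : {ffun 'I_d -> nat}.

Definition box n k : seq {ffun 'I_d -> nat} :=
  [seq [ffun i => (n i + t i).+1] | t : {dffun forall i : 'I_d, 'I_(k i)}
    <- index_enum {dffun forall i : 'I_d, 'I_(k i)}].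

Lemma box_uniq n k : uniq (box n k).
Proof.
rewrite map_inj_uniq ?index_enum_uniq// => s t /ffunP st; apply/ffunP => i.
by have := st i; rewrite !ffunE => -[] /addnI /val_inj.
Qed.

Lemma size_box n k : size (box n k) = (\prod_(i < d) k i)%N.
Proof.
rewrite size_map -sum1_size sum1_card card_dep_ffun foldrE big_map big_enum.
by apply: eq_bigr => i _; rewrite card_ord.
Qed.

Lemma mem_box n k x i : x \in box n k -> (n i < x i <= n i + k i)%N.
Proof.
move=> /mapP[t _ ->]; rewrite ffunE ltnS leq_addr/=.
by rewrite -addnS leq_add2l.
Qed.

Lemma Tbox_box {U : Type} {V : nmodType} (Y : {ffun 'I_d -> nat} -> U -> V) n k w :
  Tbox Y n k w = \sum_(j <- box n k) Y j w.
Proof. by rewrite big_map. Qed.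

Lemma box_Zpos n k x : x \in box n k -> Zpos d x.
Proof. by move=> xb i; have /andP[/(leq_ltn_trans (leq0n _))] := mem_box n k x i xb. Qed.

End boxes.

Section lattice.
Context {R : realType}.
Variables (d : nat) (alpha theta : R).
Hypothesis d0 : (0 < d)%N.
Hypothesis a0 : 0 < alpha.
Hypothesis theta1 : 1 <= theta.
Hypothesis ath : theta * alpha <= theta - 1.
Implicit Types i : {ffun 'I_d -> nat}.

Definition nu (j : nat) : nat := Num.truncn ((j%:R : R) `^ theta).

Definition lattice_point (i : {ffun 'I_d -> nat}) : {ffun 'I_d -> nat} := [ffun k => nu (i k)].

Definition lattice_box i := box d (lattice_point i) (npow alpha (lattice_point i)).

Lemma le_nu : {homo nu : m n / (m <= n)%N}.
Proof.
move=> m n mn; apply: le_truncn; apply: ge0_ler_powR; rewrite ?nnegrE ?ler_nat//.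
exact: le_trans theta1.
Qed.

Lemma nu_ge j : (j <= nu j)%N.
Proof.
case: j => // j.
rewrite truncn_ge_nat ?powR_ge0//.
by rewrite le1r_powR// ler1n.
Qed.

Lemma nu_le j : (nu j)%:R <= (j%:R : R) `^ theta.
Proof. by rewrite truncn_le powR_ge0. Qed.

Lemma nu_ge_half j : (0 < j)%N -> (j%:R : R) `^ theta / 2 <= (nu j)%:R.
Proof.
move=> j0; have := truncnS_gt ((j%:R : R) `^ theta); rewrite -/(nu j) => h.
have : (1 : R) <= (nu j)%:R by rewrite ler1n (leq_trans j0)// nu_ge.
move: h; rewrite -natr1 => h1 h2; lra.
Qed.

(** By [ath] the side is at most [j] to the power [theta - 1], and [j ^ theta + j ^ (theta - 1) = (j
    + 1) * j ^ (theta - 1) <= (j + 1) ^ theta]. *)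
Lemma nu_gap j : (0 < j)%N -> (nu j + Num.truncn (((nu j)%:R : R) `^ alpha) <= nu j.+1)%N.
Proof.
move=> j0; have jp : 1 <= (j%:R : R) by rewrite ler1n.
have jp0 : 0 < (j%:R : R) by rewrite ltr0n.
have th0 : 0 <= theta by exact: le_trans theta1.
rewrite truncn_ge_nat ?powR_ge0// natrD.
apply: (@le_trans _ _ ((j%:R : R) `^ theta + (j%:R : R) `^ (theta - 1))).
  apply: lerD; first exact: nu_le.
  apply: (@le_trans _ _ (((nu j)%:R : R) `^ alpha)); first by rewrite truncn_le powR_ge0.
  apply: (@le_trans _ _ (((j%:R : R) `^ theta) `^ alpha)).
    by apply: ge0_ler_powR; rewrite ?nnegrE ?powR_ge0 ?(ltW a0)// nu_le.
  by rewrite -powRrM ler_powR.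
have -> : (j%:R : R) `^ theta = j%:R * (j%:R : R) `^ (theta - 1).
  by rewrite mulr_powRB1// (lt_le_trans ltr01).
have -> : (j.+1%:R : R) `^ theta = j.+1%:R * (j.+1%:R : R) `^ (theta - 1).
  by rewrite mulr_powRB1// (lt_le_trans ltr01).
have -> : j%:R * (j%:R : R) `^ (theta - 1) + j%:R `^ (theta - 1) = j.+1%:R * j%:R `^ (theta - 1).
  by rewrite -natr1; ring.
by rewrite ler_wpM2l// ge0_ler_powR ?nnegrE ?subr_ge0 ?ler_nat.
Qed.

(** Each coordinate of [x] lies above [nu (i k)] and at most at [nu (i k).+1]; as [nu] is monotone,
    such intervals are disjoint for distinct indices. *)
Lemma lattice_box_disjoint i i' x : (forall k, 0 < i k)%N -> (forall k, 0 < i' k)%N ->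
  x \in lattice_box i -> x \in lattice_box i' -> i = i'.
Proof.
move=> i0 i'0 xi xi'; apply/ffunP => k.
have hb (j : {ffun 'I_d -> nat}) : (0 < j k)%N -> x \in lattice_box j -> (nu (j k) < x k <= nu (j k).+1)%N.
  move=> j0 /mem_box => /(_ k); rewrite !ffunE => /andP[-> h]/=.
  exact: leq_trans h (nu_gap _ j0).
have /andP[h1 h2] := hb i (i0 k) xi.
have /andP[h3 h4] := hb i' (i'0 k) xi'.
apply/eqP; rewrite eqn_leq; apply/andP; split; rewrite leqNgt; apply/negP => /le_nu h.
  by have := leq_trans h1 (leq_trans h4 h); rewrite ltnn.
by have := leq_trans h3 (leq_trans h2 h); rewrite ltnn.
Qed.

Lemma lattice_box_flatten_uniq (J : seq {ffun 'I_d -> nat}) : uniq J ->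
  (forall i k, i \in J -> (0 < i k)%N) -> uniq (flatten (map lattice_box J)).
Proof.
elim: J => // i J IH /= /andP[iJ uJ] J0.
have J0' i' k : i' \in J -> (0 < i' k)%N by move=> h; apply: J0; rewrite inE h orbT.
rewrite cat_uniq box_uniq IH// andbT/=.
apply/hasPn => x /flatten_mapP[i' i'J xi']; apply/negP => xi.
have ii' : i = i'.
  apply: (lattice_box_disjoint i i' x) => // k; [apply: J0|exact: J0'].
  by rewrite inE eqxx.
by rewrite ii' i'J in iJ.
Qed.

Lemma powR_prod_nat (f : 'I_d -> nat) (r : R) :
  ((\prod_(k < d) f k)%N%:R : R) `^ r = \prod_(k < d) ((f k)%:R : R) `^ r.
Proof.
rewrite natr_prod.
suff : (0 <= \prod_(k < d) ((f k)%:R : R)) /\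
   (\prod_(k < d) ((f k)%:R : R)) `^ r = \prod_(k < d) ((f k)%:R : R) `^ r by case.
elim/big_ind2 : _ => //; first by rewrite powR1.
move=> x1 y1 x2 y2 [x10 <-] [x20 <-]; split; first exact: mulr_ge0.
by rewrite powRM.
Qed.

Let L i : R := ln (normprod (lattice_point i))%:R.

Lemma normprod_gt0 i : (forall k, 0 < i k)%N -> (0 < normprod (lattice_point i))%N.
Proof.
by move=> i0; apply: prodn_gt0 => k; rewrite ffunE (leq_trans (i0 k))// nu_ge.
Qed.

Lemma expR_lnprod (r : R) i : (forall k, 0 < i k)%N ->
  expR (r * L i) = \prod_(k < d) ((nu (i k))%:R : R) `^ r.
Proof.
move=> i0; have := normprod_gt0 i i0; rewrite -(ltr0n R) => n0.
have -> : expR (r * L i) = (normprod (lattice_point i))%:R `^ r.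
  by rewrite /powR gt_eqF.
by rewrite powR_prod_nat; apply: eq_bigr => k _; rewrite ffunE.
Qed.

Lemma lnprod_ge (x : R) : exists2 N, (0 < N)%N & forall i, (forall k, N <= i k)%N -> x <= L i.
Proof.
exists (Num.truncn (expR x)).+1 => // i iN.
have i0 k : (0 < i k)%N by exact: leq_ltn_trans (iN k).
have := normprod_gt0 i i0; rewrite -(ltr0n R) => n0.
rewrite -ler_expR lnK ?posrE//.
apply: ltW; apply: lt_le_trans (truncnS_gt _) _; rewrite ler_nat.
(* One coordinate beyond [expR x] suffices, the others being at least 1. *)
apply: (leq_trans (iN (Ordinal d0))).
rewrite /normprod (bigD1 (Ordinal d0))//= ffunE.
rewrite (leq_trans (nu_ge _))// leq_pmulr// prodn_gt0// => k.
by rewrite ffunE (leq_trans (i0 k))// nu_ge.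
Qed.

Lemma size_lattice_box_le i : (forall k, 0 < i k)%N ->
  (size (lattice_box i))%:R <= expR (alpha * L i).
Proof.
move=> i0; rewrite size_box expR_lnprod// natr_prod; apply: ler_prod => k _.
by rewrite ler0n/= !ffunE truncn_le powR_ge0.
Qed.

Lemma bernoulli_prod (f : 'I_d -> R) (y : R) : 0 <= y <= 1 ->
  (forall k, 1 - y <= f k) -> 1 - d%:R * y <= \prod_(k < d) f k.
Proof.
move=> /andP[y0 y1] fy.
apply: (@le_trans _ _ ((1 - y) ^+ d)); last first.
  rewrite -[in leLHS](card_ord d) -prodr_const; apply: ler_prod => k _.
  by rewrite subr_ge0 y1 fy.
elim: (d) => [|m IH]; first by rewrite mul0r subr0 expr0.
rewrite exprS -natr1.
have : (1 - y) * (1 - m%:R * y) <= (1 - y) * (1 - y) ^+ m by rewrite ler_wpM2l// subr_ge0.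
apply: le_trans; have : 0 <= m%:R * y ^+ 2 by rewrite mulr_ge0// sqr_ge0.
lra.
Qed.

(** Rounding down costs less than 1 on each side, a relative error of at most [y] once the side
    reaches [y^-1]. Bernoulli's inequality adds the [d] errors up to at most [kappa]. *)
Lemma size_lattice_box_ge (kappa : R) : 0 < kappa ->
  exists2 N, (0 < N)%N & forall i, (forall k, N <= i k)%N ->
  (1 - kappa) * expR (alpha * L i) <= (size (lattice_box i))%:R.
Proof.
move=> k0; pose y := Num.min 1 (kappa / d%:R).
have dp : 0 < (d%:R : R) by rewrite ltr0n.
have y0 : 0 < y by rewrite lt_min ltr01 /=; exact: divr_gt0.
have y1 : y <= 1 by rewrite ge_min lexx.
have dy : d%:R * y <= kappa by rewrite mulrC -ler_pdivlMr// ge_min lexx orbT.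
exists (Num.truncn (y^-1 `^ alpha^-1)).+1 => // i iN.
have i0 k : (0 < i k)%N by exact: leq_ltn_trans (iN k).
rewrite size_box expR_lnprod// natr_prod.
have nu0 k : 0 < ((nu (i k))%:R : R) by rewrite ltr0n (leq_trans (i0 k))// nu_ge.
have p0 k : 0 < ((nu (i k))%:R : R) `^ alpha by exact: powR_gt0.
have pge k : y^-1 <= ((nu (i k))%:R : R) `^ alpha.
  have -> : y^-1 = (y^-1 `^ alpha^-1) `^ alpha.
    by rewrite -powRrM mulVf ?gt_eqF// powRr1// invr_ge0 ltW.
  apply: ge0_ler_powR; rewrite ?nnegrE ?powR_ge0 ?(ltW a0)//.
  apply: ltW; apply: lt_le_trans (truncnS_gt _) _; rewrite ler_nat.
  exact: leq_trans (iN k) (nu_ge _).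
have fk k : 1 - y <= (npow alpha (lattice_point i) k)%:R / ((nu (i k))%:R : R) `^ alpha.
  rewrite !ffunE ler_pdivlMr// mulrBl mul1r.
  have := truncnS_gt (((nu (i k))%:R : R) `^ alpha).
  rewrite -natr1 => h.
  have : y * y^-1 <= y * ((nu (i k))%:R : R) `^ alpha by rewrite ler_wpM2l// ltW.
  rewrite divff ?gt_eqF// => h2; lra.
have := bernoulli_prod _ y _ fk; rewrite (ltW y0) y1 => /(_ isT).
rewrite prodf_div ler_pdivlMr; last by apply: prodr_gt0.
apply: le_trans; rewrite ler_wpM2r//; first by apply: prodr_ge0 => k _; exact: powR_ge0.
by rewrite lerD2l lerN2.
Qed.

(** The integer part [nu j] is at least half of [j ^ theta], which costs a factor [2 ^ r] in each
    coordinate. *)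
Lemma expRN_lnprod_le (r : R) i : 0 <= r -> (forall k, 0 < i k)%N ->
  expR (- (r * L i)) <= (2 `^ r) ^+ d * \prod_(k < d) ((i k)%:R : R) `^ (- (theta * r)).
Proof.
move=> r0 i0; rewrite -mulNr expR_lnprod//.
have -> : (2 `^ r) ^+ d = \prod_(k < d) 2 `^ r :> R by rewrite prodr_const card_ord.
rewrite -big_split/=; apply: ler_prod => k _.
rewrite powR_ge0/=.
have ip : 0 < ((i k)%:R : R) by rewrite ltr0n.
have xp : 0 < ((i k)%:R : R) `^ theta / 2 by rewrite divr_gt0// powR_gt0.
have -> : 2 `^ r * ((i k)%:R : R) `^ (- (theta * r)) = (((i k)%:R : R) `^ theta / 2) `^ (- r).
  rewrite powRM ?powR_ge0// -powRrM mulrN mulrC; congr (_ * _).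
  by rewrite -[2^-1]powR_inv1// -powRrM mulrNN mul1r.
rewrite !powRN lef_pV2 ?posrE ?powR_gt0 ?(lt_le_trans xp)// ?nu_ge_half//.
by apply: ge0_ler_powR; rewrite ?nnegrE ?(ltW xp)// nu_ge_half.
Qed.

Lemma expRN_lnprod_ge i : (forall k, 0 < i k)%N ->
  \prod_(k < d) ((i k)%:R : R)^-1 <= expR (- (L i / theta)).
Proof.
move=> i0; rewrite -mulrN mulrC expR_lnprod//; apply: ler_prod => k _.
have ip : 0 < ((i k)%:R : R) by rewrite ltr0n.
have nu0 : 0 < ((nu (i k))%:R : R) by rewrite ltr0n (leq_trans (i0 k))// nu_ge.
have th0 : 0 < theta by exact: lt_le_trans theta1.
rewrite invr_ge0 (ltW ip)/= powRN lef_pV2 ?posrE ?powR_gt0//.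
have -> : ((i k)%:R : R) = (((i k)%:R : R) `^ theta) `^ theta^-1.
  by rewrite -powRrM divff ?gt_eqF// powRr1// ltW.
by apply: ge0_ler_powR; rewrite ?nnegrE ?powR_ge0 ?invr_ge0 ?(ltW th0)// nu_le.
Qed.

End lattice.

(** * Almost sure bounds for the normalized sums *)

Section almost_sure.
Context {R : realType} {dT : measure_display} {T : measurableType dT}.
Variable P : probability T R.
Variables (d : nat) (alpha beta : R).
Hypotheses (d0 : (0 < d)%N) (a01 : 0 < alpha < 1) (b1 : 1 < beta).

Implicit Types i n : {ffun 'I_d -> nat}.

Definition normalized_sum (Y : {ffun 'I_d -> nat} -> T -> R) n w : R :=
  Tbox Y n (npow alpha n) w
  / Num.sqrt (2 * ((normprod n)%:R `^ alpha) * ln (normprod n)%:R).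

Let theta : R := beta / (1 - alpha).
Let point := lattice_point d theta.
Let L i : R := ln (normprod (point i))%:R.

Let a0 : 0 < alpha. Proof. by case/andP: a01. Qed.
Let a1 : 0 < 1 - alpha. Proof. by rewrite subr_gt0; case/andP: a01. Qed.
Let th0 : 0 < theta. Proof. by apply: divr_gt0 => //; exact: lt_trans ltr01 b1. Qed.
Let thE : theta * (1 - alpha) = beta. Proof. by rewrite /theta divfK// gt_eqF. Qed.
Let th1 : 1 <= theta.
Proof.
rewrite ler_pdivlMr// mul1r; have := a0; have := b1; lra.
Qed.
Let ath : theta * alpha <= theta - 1.
Proof. by have := thE; have := b1; rewrite mulrBr mulr1; lra. Qed.

(** The limit runs over points [n], the Borel-Cantelli lemmas over indices [i]; monotonicity of [nu]
    carries lower bounds from points to indices. *)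
Lemma LambdaStar_ge N n : (forall k, LambdaStar alpha beta (n k)) ->
  (forall k, nu theta N < n k)%N ->
  exists2 i : {ffun 'I_d -> nat}, (forall k, (0 < i k)%N /\ (N <= i k)%N) & n = point i.
Proof.
move=> nL nN.
have h k : {j | (0 < j)%N /\ n k = nu theta j}.
  by apply: cid; have [j j0 jE] := nL k; exists j.
exists [ffun k => sval (h k)] => [k|]; last first.
  by apply/ffunP => k; rewrite !ffunE; have [] := svalP (h k).
rewrite ffunE; have [j0 jE] := svalP (h k); split=> //.
rewrite leqNgt; apply/negP => /ltnW /(le_nu theta th1); rewrite -jE leqNgt.
by rewrite nN.
Qed.

Lemma LambdaStar_point i : (forall k, 0 < i k)%N -> forall k, LambdaStar alpha beta (point i k).
Proof. by move=> i0 k; rewrite ffunE; exists (i k). Qed.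

Lemma normalized_sumE Y i w : (forall k, 0 < i k)%N ->
  normalized_sum Y (point i) w =
  (\sum_(j <- lattice_box d alpha theta i) Y j w) / Num.sqrt (2 * expR (alpha * L i) * L i).
Proof.
move=> i0; rewrite /normalized_sum Tbox_box; congr (_ / Num.sqrt (_ * _ * _)).
have := normprod_gt0 d theta th1 i i0; rewrite -(ltr0n R) => n0.
by rewrite /powR gt_eqF.
Qed.

Variable Y : {ffun 'I_d -> nat} -> {RV P >-> R}.
Hypothesis indY : mutually_independent (Zpos d) Y.

Let x c i := c * Num.sqrt (2 * expR (alpha * L i) * L i).
Let S i w := \sum_(j <- lattice_box d alpha theta i) Y j w.
Let E c i := [set w | x c i <= S i w].

Let E_preimage c i : E c i = S i @^-1` `[x c i, +oo[.
Proof. by apply/funext => w /=; rewrite in_itv/= andbT. Qed.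

Let mE c i : measurable (E c i).
Proof.
rewrite E_preimage -[X in measurable X]setTI.
have mS : measurable_fun setT (S i) by apply: measurable_sum.
exact: mS.
Qed.

Lemma ae_normalized_sum_lt (v p C c : R) : 0 <= v -> 0 <= C -> 0 < c ->
  v < c ^+ 2 * theta -> 2 < p -> theta^-1 < alpha * (p / 2 - 1) ->
  (forall i, Zpos d i -> P.-integrable setT (EFin \o Y i)) ->
  (forall i, Zpos d i -> \int[P]_w (Y i w)%:E = 0)%E ->
  (forall i, Zpos d i -> \int[P]_w ((Y i w) ^+ 2)%:E = v%:E)%E ->
  (forall i, Zpos d i -> \int[P]_w (`|Y i w| `^ p)%:E <= C%:E)%E ->
  {ae P, forall w, exists N, forall n, (forall k, LambdaStar alpha beta (n k)) ->
     (forall k, N <= n k)%N -> normalized_sum (fun k => Y k : T -> R) n w < c}.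
Proof.
move=> v0 C0 c0 vc p2 thp iY Y0 Yv YC.
have [r [K [L0 [thr K0 hP]]]] := probability_sum_le P (Zpos d) Y indY alpha theta
  v p C c a0 th0 v0 C0 c0 vc p2 thp iY Y0 Yv YC.
have r0 : 0 <= r by apply: ltW; apply: lt_trans thr; rewrite invr_gt0.
(* Besides [L0], the bound [1 <= L i] keeps the normalizing square root positive. *)
have [N1 N10 LN1] := lnprod_ge d theta d0 th1 (Num.max 1 L0).
have rho1 : 1 < theta * r by rewrite -ltr_pdivrMl// mulr1.
have C'0 : 0 <= K * (2 `^ r) ^+ d by rewrite mulr_ge0// exprn_ge0// powR_ge0.
have := @borel_cantelli_lattice1 R dT T P d d0 (E c) (mE c) (theta * r) _ N1 rho1 C'0.
have PE i : (forall k, N1 <= i k)%N ->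
   (P (E c i) <= (K * (2 `^ r) ^+ d * \prod_(k < d) (i k)%:R `^ (- (theta * r)))%:E)%E.
  move=> iN; have i0 k : (0 < i k)%N by rewrite (leq_trans N10).
  have := LN1 i iN; rewrite ge_max => /andP[_ LL0].
  apply: le_trans (hP (lattice_box d alpha theta i) (L i) (box_uniq _ _ _) _ LL0 _) _.
  - by move=> j; exact: box_Zpos.
  - exact: size_lattice_box_le.
  - by rewrite lee_fin -mulrA ler_wpM2l// expRN_lnprod_le.
move=> /(_ PE); apply: filterS => w [N2 hN2].
exists (nu theta (N1 + N2)).+1 => n nL nN.
have [i hi ->] := LambdaStar_ge (N1 + N2) n nL nN.
have i0 k : (0 < i k)%N by case: (hi k).
have iN1 k : (N1 <= i k)%N by case: (hi k) => _; exact/leq_trans/leq_addr.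
have iN2 k : (N2 <= i k)%N by case: (hi k) => _; exact/leq_trans/leq_addl.
have := LN1 i iN1; rewrite ge_max => /andP[L1 _].
rewrite normalized_sumE// ltr_pdivrMr; last first.
  by rewrite sqrtr_gt0 !mulr_gt0 ?expR_gt0//; apply: lt_le_trans L1.
by rewrite ltNge; apply/negP; exact: hN2.
Qed.

Lemma ae_normalized_sum_ge (v B c : R) : 0 < v -> 0 < B -> 0 <= c ->
  c < Num.sqrt (v / theta) ->
  (forall i w, Zpos d i -> `|Y i w| <= B) ->
  (forall i, Zpos d i -> \int[P]_w (Y i w)%:E = 0)%E ->
  (forall i, Zpos d i -> \int[P]_w ((Y i w) ^+ 2)%:E = v%:E)%E ->
  {ae P, forall w, forall N, exists n : {ffun 'I_d -> nat}, [/\ forall k, LambdaStar alpha beta (n k),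
     (forall k, N <= n k)%N & c <= normalized_sum (fun k => Y k : T -> R) n w]}.
Proof.
move=> v0 B0 c0 cv YB Y0 Yv.
have [kappa [L0 [k0 hP]]] := probability_sum_ge P (Zpos d) Y indY alpha theta
  v B c a0 th0 v0 B0 c0 cv YB Y0 Yv.
have [N1 N10 LN1] := lnprod_ge d theta d0 th1 (Num.max 1 L0).
have [N2 N20 sN2] := size_lattice_box_ge d alpha theta d0 a0 th1 kappa k0.
have h0 : 0 < 2^-1 :> R by rewrite invr_gt0.
have := @borel_cantelli_lattice2 R dT T P d d0 (E c) (mE c) 2^-1 (N1 + N2) h0.
(* Boxes at distinct indices are disjoint, so these events belong to sigma-algebras of disjoint
   blocks of variables. *)
have ind (J : seq {ffun 'I_d -> nat}) : uniq J -> (forall i k, i \in J -> (0 < i k)%N) ->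
    P (\big[setI/setT]_(i <- J) ~` E c i) = (\prod_(i <- J) P (~` E c i))%E.
  move=> uJ J0.
  have := @indep_sigma_cylinders R dT T P _ (Zpos d) Y indY _ J
    (lattice_box d alpha theta) (fun i => ~` E c i) [::] setT.
  rewrite cats0 setIT probability_setT mule1; apply.
  - move=> i _; rewrite E_preimage preimage_setC.
    by apply: sum_cylinders; apply: measurableC.
  - by exists (fun=> setT) => //; rewrite big_nil.
  - exact: lattice_box_flatten_uniq.
  - by move=> j /flatten_mapP[i _]; exact: box_Zpos.
have PE i : (forall k, N1 + N2 <= i k)%N ->
   ((2^-1 * \prod_(k < d) (i k)%:R^-1)%:E <= P (E c i))%E.
  move=> iN; have iN1 k : (N1 <= i k)%N by exact: leq_trans (leq_addr _ _) (iN k).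
  have iN2 k : (N2 <= i k)%N by exact: leq_trans (leq_addl _ _) (iN k).
  have i0 k : (0 < i k)%N by rewrite (leq_trans N10).
  have := LN1 i iN1; rewrite ge_max => /andP[_ LL0].
  apply: le_trans _ (hP (lattice_box d alpha theta i) (L i) (box_uniq _ _ _) _ LL0 _).
  - by rewrite lee_fin ler_wpM2l// expRN_lnprod_ge.
  - by move=> j; exact: box_Zpos.
  - by rewrite sN2//= size_lattice_box_le.
move=> /(_ ind PE); apply: filterS => w hw N.
have [i hi Ei] := hw (N1 + N)%N.
have iN1 k : (N1 <= i k)%N by exact: leq_trans (leq_addr _ _) (hi k).
have i0 k : (0 < i k)%N by exact: leq_trans N10 (iN1 k).
have := LN1 i iN1; rewrite ge_max => /andP[L1 _].
exists (point i); split.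
- exact: LambdaStar_point.
- by move=> k; rewrite ffunE (leq_trans _ (nu_ge theta th1 _))// (leq_trans (leq_addl _ _) (hi k)).
- rewrite normalized_sumE// ler_pdivlMr//.
  by rewrite sqrtr_gt0 !mulr_gt0 ?expR_gt0//; apply: lt_le_trans L1.
Qed.

End almost_sure.

(** * Limits and truncation *)

Section limits_along.
Context {I : Type} {R : realType}.
Implicit Types (f : I -> R) (F : set (set I)) (l : R).

Lemma limsup_along_eq f F l :
  (forall eta, 0 < eta -> exists2 V, F V & forall n, V n -> f n <= l + eta) ->
  (forall eta V, 0 < eta -> F V -> exists2 n, V n & l - eta <= f n) ->
  limsup_along (fun n => (f n)%:E) F = l%:E.
Proof.
move=> up lo; apply/eqP; rewrite eq_le; apply/andP; split.
  apply/lee_addgt0Pr => eta eta0; have [V FV Vle] := up eta eta0.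
  apply: (@le_trans _ _ (ereal_sup ((fun n => (f n)%:E) @` V))).
    by apply: ereal_inf_lbound; exists V.
  by apply: ge_ereal_sup => _ [n Vn <-]; rewrite lee_fin Vle.
apply: le_ereal_inf_tmp => _ [V FV <-].
apply/lee_subgt0Pr => eta eta0; have [n Vn len] := lo eta V eta0 FV.
rewrite -EFinB; apply: (@le_trans _ _ (f n)%:E); first by rewrite lee_fin.
by apply: ereal_sup_ubound; exists n.
Qed.

Lemma liminf_along_eq f F l :
  (forall eta, 0 < eta -> exists2 V, F V & forall n, V n -> l - eta <= f n) ->
  (forall eta V, 0 < eta -> F V -> exists2 n, V n & f n <= l + eta) ->
  liminf_along (fun n => (f n)%:E) F = l%:E.
Proof.
move=> lo up; apply/eqP; rewrite eq_le; apply/andP; split.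
  apply: ge_ereal_sup => _ [V FV <-].
  apply/lee_addgt0Pr => eta eta0; have [n Vn len] := up eta V eta0 FV.
  apply: (@le_trans _ _ (f n)%:E); last by rewrite -EFinD lee_fin.
  by apply: ereal_inf_lbound; exists n.
apply/lee_subgt0Pr => eta eta0; have [V FV Vle] := lo eta eta0.
apply: (@le_trans _ _ (ereal_inf ((fun n => (f n)%:E) @` V))); last first.
  by apply: ereal_sup_ubound; exists V.
by apply: le_ereal_inf_tmp => _ [n Vn <-]; rewrite -EFinB lee_fin Vle.
Qed.

End limits_along.

(** * Moments, and splitting a variable into a bounded part and a small part *)

Section moments.
Context {R : realType} {dT : measure_display} {T : measurableType dT}.
Variable P : probability T R.

Lemma same_distribution_integral (Y X : {RV P >-> R}) (f : R -> \bar R) :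
  measurable_fun setT f -> same_distribution Y X ->
  (\int[P]_w f (Y w) = \int[P]_w f (X w))%E.
Proof.
move=> mf YX.
have ge0 (g : R -> \bar R) : measurable_fun setT g -> (forall x, 0 <= g x)%E ->
    (\int[P]_w g (Y w) = \int[P]_w g (X w))%E.
  move=> mg g0.
  have := @ge0_integral_pushforward _ _ T R R Y (measurable_funPT Y) P setT g measurableT mg (fun x _ => g0 x).
  have := @ge0_integral_pushforward _ _ T R R X (measurable_funPT X) P setT g measurableT mg (fun x _ => g0 x).
  rewrite !preimage_setT => <- <-.
  apply: eq_measure_integral => A mA _; exact: YX.
rewrite integralE [RHS]integralE; congr (_ - _)%E.
- have := ge0 (f^\+)%E (measurable_funepos mf) (funepos_ge0 f).
  by rewrite !funepos.unlock.
- have := ge0 (f^\-)%E (measurable_funeneg mf) (funeneg_ge0 f).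
  by rewrite !funeneg.unlock.
Qed.

(** A power of [logplus] of either sign is absorbed by [x] to the power [q - p], since
    [logplus y <= C1 * y ^ s] with [s = (q - p) / e']. For [x <= 1] the constant 1 is enough. *)
Lemma logplus_powR_bound (q p e : R) : 0 < p -> p < q ->
  exists2 C : R, 0 <= C & forall x : R, 0 <= x -> x `^ p <= 1 + C * (x `^ q * logplus x `^ e).
Proof.
move=> p0 pq; pose e' := Num.max `|e| 1.
have e'0 : 0 < e' by rewrite lt_max ltr01 orbT.
pose s := (q - p) / e'.
have s0 : 0 < s by rewrite divr_gt0// subr_gt0.
pose C1 := Num.max s^-1 1.
have C10 : 0 <= C1 by rewrite le_max ler01 orbT.
exists (C1 `^ e'); first exact: powR_ge0.
move=> y y0; have [y1|y1] := leP y 1.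
  apply: (@le_trans _ _ 1); last by rewrite lerDl !mulr_ge0 ?powR_ge0.
  apply: (@le_trans _ _ (1 `^ p)); last by rewrite powR1.
  by rewrite ge0_ler_powR ?nnegrE// ltW.
have yp : 0 < y by exact: lt_trans y1.
have l1 : 1 <= logplus y by rewrite le_max lexx orbT.
have l0 : 0 < logplus y by exact: lt_le_trans l1.
have ys1 : 1 <= y `^ s by rewrite -[leLHS](@powRr0 _ y) ler_powR ?(ltW y1)// ltW.
have lle : logplus y <= C1 * y `^ s.
  rewrite ge_max; apply/andP; split; last first.
    by rewrite -[leLHS]mul1r ler_pM// le_max lexx orbT.
  have lny : ln y = s^-1 * ln (y `^ s) by rewrite ln_powR mulKf// gt_eqF.
  rewrite lny ler_pM ?invr_ge0 ?(ltW s0) ?ln_ge0// ?le_max ?lexx//.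
  by rewrite ltW// ln_sublinear// powR_gt0.
have h : (logplus y) `^ (- e) <= C1 `^ e' * y `^ (q - p).
  apply: (@le_trans _ _ ((logplus y) `^ e')).
    by apply: ler_powR => //; rewrite le_max -normrN ler_norm.
  apply: (@le_trans _ _ ((C1 * y `^ s) `^ e')).
    by apply: ge0_ler_powR; rewrite ?nnegrE ?(ltW e'0) ?(ltW l0) ?mulr_ge0 ?powR_ge0.
  by rewrite powRM ?powR_ge0// -powRrM /s divfK// gt_eqF.
have -> : y `^ p = y `^ p * ((logplus y) `^ (- e) * (logplus y) `^ e).
  by rewrite powRN mulVf ?mulr1// gt_eqF// powR_gt0.
rewrite (@le_trans _ _ (y `^ p * (C1 `^ e' * y `^ (q - p) * logplus y `^ e)))//.
  by rewrite ler_wpM2l ?powR_ge0// ler_wpM2r ?powR_ge0.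
have -> : y `^ q = y `^ p * y `^ (q - p).
  rewrite -powRD ?subrKC//; by rewrite (gt_eqF yp) implybT.
rewrite -[leLHS]add0r lerD// le_eqVlt; apply/orP; left; apply/eqP; ring.
Qed.

Lemma powRD_le (p a c : R) : 0 <= p -> 0 <= a -> 0 <= c ->
  (a + c) `^ p <= 2 `^ p * a `^ p + 2 `^ p * c `^ p.
Proof.
move=> p0 ha hc; rewrite -!powRM//.
have [ac|ca] := leP a c.
- rewrite -[leLHS]add0r lerD ?powR_ge0// ge0_ler_powR ?nnegrE ?addr_ge0 ?mulr_ge0//; lra.
- rewrite -[leLHS]addr0 lerD ?powR_ge0// ge0_ler_powR ?nnegrE ?addr_ge0 ?mulr_ge0//; lra.
Qed.

Variables (X : {RV P >-> R}) (p : R).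
Hypothesis p0 : 0 <= p.

Lemma moment_le (f : R -> R) (C M : R) : measurable_fun setT f ->
  (\int[P]_w (`|X w| `^ p)%:E <= C%:E)%E -> 0 <= M ->
  (forall x, `|f x| <= `|x| + M) ->
  exists2 C', 0 <= C' & (\int[P]_w (`|f (X w)| `^ p)%:E <= C'%:E)%E.
Proof.
move=> mf XC M0 fM.
have C0 : 0 <= C.
  rewrite -lee_fin; apply: le_trans XC; apply: integral_ge0 => w _.
  by rewrite lee_fin powR_ge0.
exists (2 `^ p * C + 2 `^ p * M `^ p); first by rewrite addr_ge0 ?mulr_ge0 ?powR_ge0.
have mX : measurable_fun setT X by [].
have mpow (g : T -> R) : measurable_fun setT g -> measurable_fun setT (fun w => `|g w| `^ p).
  move=> mg; apply: (measurableT_comp (@measurable_powR R p)).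
  exact: measurableT_comp.
apply: (@le_trans _ _ (\int[P]_w ((2 `^ p)%:E * (`|X w| `^ p)%:E + (2 `^ p * M `^ p)%:E))%E).
  apply: ge0_le_integral => //.
  - by apply/measurable_EFinP; apply: mpow; exact: measurableT_comp mf mX.
  - apply: emeasurable_funD => //; apply: emeasurable_funM => //.
    by apply/measurable_EFinP; exact: mpow.
  - move=> w _; rewrite -EFinM -EFinD lee_fin.
    apply: le_trans (powRD_le p `|X w| M p0 _ M0) => //.
    by rewrite ge0_ler_powR ?nnegrE ?addr_ge0.
rewrite ge0_integralD//; last 2 first.
- by apply: emeasurable_funM => //; apply/measurable_EFinP; exact: mpow.
- by move=> w _; rewrite lee_fin mulr_ge0 ?powR_ge0.
have -> : (\int[P]_w (2 `^ p * M `^ p)%:E = (2 `^ p * M `^ p)%:E)%E.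
  by rewrite integral_cst// [X in (_ * X)%E]probability_setT mule1.
rewrite ge0_integralZl_EFin ?powR_ge0//; last first.
  by apply/measurable_EFinP; exact: mpow.
by rewrite EFinD leeD2r// EFinM lee_wpmul2l// lee_fin powR_ge0.
Qed.

(** Cut [x] at [|x| <= b] into [h x + k x] and recenter by [m], the mean of [h (X w)]; that of
    [k (X w)] is [- m]. As [h x * k x = 0], the second moments add up to [s2]. *)
Lemma truncation_decomposition (s2 eps Cp : R) :
  2 < p -> P.-integrable setT (EFin \o X) -> (\int[P]_w (X w)%:E = 0)%E ->
  (\int[P]_w ((X w) ^+ 2)%:E = s2%:E)%E ->
  (\int[P]_w (`|X w| `^ p)%:E <= Cp%:E)%E -> 0 < eps ->
  exists f g : R -> R, exists B M v1 v2, [/\ [/\ measurable_fun setT f & measurable_fun setT g],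
    [/\ forall x, x = f x + g x, forall x, `|f x| <= B & forall x, `|g x| <= `|x| + M],
    [/\ (\int[P]_w (f (X w))%:E = 0)%E, (\int[P]_w (g (X w))%:E = 0)%E,
       (\int[P]_w ((f (X w)) ^+ 2)%:E = v1%:E)%E & (\int[P]_w ((g (X w)) ^+ 2)%:E = v2%:E)%E] &
    [/\ 0 < B, 0 <= M, s2 - eps <= v1 & 0 <= v2 <= eps]].
Proof.
move=> p2 iX X0 X2 Xp e0.
have Cp0 : 0 <= Cp.
  rewrite -lee_fin; apply: le_trans Xp; apply: integral_ge0 => w _.
  by rewrite lee_fin powR_ge0.
have q0 : 0 < p - 2 by lra.
(* With this level the moment of order [p] bounds the second moment of [k (X w)] by [eps / 2];
   [Cp + 1] keeps the level positive when [Cp = 0]. *)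
pose b := (2 * (Cp + 1) / eps) `^ (p - 2)^-1.
have y0 : 0 < 2 * (Cp + 1) / eps by apply: divr_gt0 => //; lra.
have b0 : 0 < b by exact: powR_gt0.
have bE : b `^ (p - 2) = 2 * (Cp + 1) / eps.
  by rewrite /b -powRrM mulVf ?gt_eqF// powRr1// ltW.
pose A : set R := [set x | `|x| <= b].
have mA : measurable A.
  have -> : A = Num.norm @^-1` `]-oo, b]%classic by apply/funext => x /=; rewrite in_itv.
  rewrite -[X in measurable X]setTI.
  exact: (@normr_measurable R setT).
pose h (x : R) := x * \1_A x; pose k (x : R) := x * \1_(~` A) x.
have hk x : x = h x + k x.
  rewrite /h /k -mulrDr !indicE in_setC.
  by case: (x \in A); rewrite /= ?addr0 ?add0r mulr1.
have hk0 x : h x * k x = 0.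
  rewrite /h /k !indicE in_setC.
  by case: (x \in A); rewrite /= ?mulr0 ?mul0r.
have hb x : `|h x| <= b.
  rewrite /h indicE; case: (boolP (x \in A)) => [/set_mem xA|_]; first by rewrite mulr1.
  by rewrite mulr0 normr0 ltW.
have kx x : `|k x| <= `|x|.
  by rewrite /k indicE; case: (x \in ~` A); rewrite ?mulr1// mulr0 normr0.
have hx x : `|h x| <= `|x|.
  by rewrite /h indicE; case: (x \in A); rewrite ?mulr1// mulr0 normr0.
have mh : measurable_fun setT h.
  by apply: measurable_funM => //; exact: measurable_indic.
have mk : measurable_fun setT k.
  by apply: measurable_funM => //; apply: measurable_indic; exact: measurableC.
have mX : measurable_fun setT X by [].
have mhX : measurable_fun setT (fun w => h (X w)) by exact: measurableT_comp mh mX.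
have mkX : measurable_fun setT (fun w => k (X w)) by exact: measurableT_comp mk mX.
have ih : P.-integrable setT (fun w => (h (X w))%:E).
  apply: le_integrable iX => //; first exact/measurable_EFinP.
  by move=> w _ /=; rewrite lee_fin.
have ik : P.-integrable setT (fun w => (k (X w))%:E).
  apply: le_integrable iX => //; first exact/measurable_EFinP.
  by move=> w _ /=; rewrite lee_fin.
have iX2 : P.-integrable setT (fun w => (X w ^+ 2)%:E).
  apply/integrableP; split.
    by apply/measurable_EFinP; exact: measurable_funX.
  by under eq_integral do rewrite gee0_abs ?lee_fin ?sqr_ge0//; rewrite X2 ltry.
have ih2 : P.-integrable setT (fun w => (h (X w) ^+ 2)%:E).
  apply: le_integrable iX2 => //; first by apply/measurable_EFinP; exact: measurable_funX.
  by move=> w _ /=; rewrite lee_fin !normrX lerXn2r ?nnegrE.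
have ik2 : P.-integrable setT (fun w => (k (X w) ^+ 2)%:E).
  apply: le_integrable iX2 => //; first by apply/measurable_EFinP; exact: measurable_funX.
  by move=> w _ /=; rewrite lee_fin !normrX lerXn2r ?nnegrE.
have fin (F : T -> \bar R) : P.-integrable setT F -> {m | (\int[P]_w F w = m%:E)%E}.
  move=> iF; exists (fine (\int[P]_w F w)%E); rewrite fineK//.
  exact: integrable_fin_num.
have [m mE] := fin _ ih; have [m' m'E] := fin _ ik.
have [h2 h2E] := fin _ ih2; have [t tE] := fin _ ik2.
have mm' : m' = - m.
  have : (\int[P]_w (X w)%:E = m%:E + m'%:E)%E.
    rewrite -mE -m'E -integralD//; apply: eq_integral => w _.
    by rewrite -EFinD -hk.
  rewrite X0 -EFinD => /eqP; rewrite eqe eq_sym addrC addr_eq0 => /eqP ->//.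
have s2E : s2 = h2 + t.
  have : (\int[P]_w (X w ^+ 2)%:E = h2%:E + t%:E)%E.
    rewrite -h2E -tE -integralD//; apply: eq_integral => w _.
    by rewrite -EFinD {1}(hk (X w)) sqrrD -mulr_natl hk0 mulr0 addr0.
  by rewrite X2 -EFinD => -[].
have quad (F : T -> R) (c u u2 : R) :
    P.-integrable setT (fun w => (F w)%:E) -> P.-integrable setT (fun w => (F w ^+ 2)%:E) ->
    (\int[P]_w (F w)%:E = u%:E)%E -> (\int[P]_w (F w ^+ 2)%:E = u2%:E)%E ->
    (\int[P]_w (F w + c)%:E = (u + c)%:E)%E /\
    (\int[P]_w ((F w + c) ^+ 2)%:E = (u2 + 2 * c * u + c ^+ 2)%:E)%E.
  move=> i1 i2 e1 e2.
  have ic (y : R) : P.-integrable setT (fun=> y%:E) by exact: finite_measure_integrable_cst.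
  have cst (y : R) : (\int[P]_w y%:E = y%:E)%E.
    by rewrite integral_cst// [X in (_ * X)%E]probability_setT mule1.
  split.
    under eq_integral do rewrite EFinD.
    by rewrite integralD// e1 cst EFinD.
  have e (w : T) : ((F w + c) ^+ 2)%:E = ((F w ^+ 2)%:E + (2 * c)%:E * (F w)%:E + (c ^+ 2)%:E)%E.
    by rewrite -EFinM -!EFinD; congr (_%:E); ring.
  under eq_integral do rewrite e.
  rewrite integralD//; last by apply: integrableD => //; exact: integrableZl.
  rewrite integralD//; last exact: integrableZl.
  by rewrite integralZl// e1 e2 cst -EFinM -!EFinD.
have [f1 f2] := quad _ (- m) _ _ ih ih2 mE h2E.
have [g1 g2] := quad _ m _ _ ik ik2 m'E tE.
have v20 : 0 <= t + 2 * m * m' + m ^+ 2.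
  rewrite -lee_fin -g2; apply: integral_ge0 => w _; by rewrite lee_fin sqr_ge0.
have te : t <= eps / 2.
  have bp : 0 < b `^ (p - 2) by exact: powR_gt0.
  have kp x : b `^ (p - 2) * k x ^+ 2 <= `|x| `^ p.
    rewrite /k indicE in_setC; case: (boolP (x \in A)) => [_|/negP xA].
      by rewrite mulr0 expr0n/= mulr0 powR_ge0.
    have bx : b < `|x|.
      by rewrite ltNge; apply/negP => xb; apply: xA; exact/mem_set.
    have x0 : 0 < `|x| by exact: lt_trans bx.
    have -> : `|x| `^ p = `|x| `^ (p - 2) * `|x| ^+ 2.
      rewrite -powR_mulrn// -powRD ?subrK//; by rewrite (gt_eqF x0) implybT.
    rewrite mulr1 real_normK ?num_real// ler_wpM2r ?sqr_ge0//.
    by rewrite ge0_ler_powR ?nnegrE// ltW.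
  have : ((b `^ (p - 2))%:E * t%:E <= Cp%:E)%E.
    rewrite -tE -ge0_integralZl_EFin ?powR_ge0//; last 2 first.
    - by move=> w _; rewrite lee_fin sqr_ge0.
    - by apply/measurable_EFinP; exact: measurable_funX.
    apply: le_trans Xp; apply: ge0_le_integral => //.
    - by move=> w _; rewrite -EFinM lee_fin mulr_ge0 ?sqr_ge0 ?powR_ge0.
    - apply: emeasurable_funM => //; apply/measurable_EFinP; exact: measurable_funX.
    - apply/measurable_EFinP; apply: (measurableT_comp (@measurable_powR R p)).
      exact: measurableT_comp.
    - by move=> w _; rewrite -EFinM lee_fin.
  rewrite -EFinM lee_fin bE => ht.
  have : 2 * (Cp + 1) / eps * t <= Cp + 1 by lra.
  rewrite mulrAC ler_pdivrMr// [leRHS]mulrC => h3.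
  have Cp1 : 0 < Cp + 1 by lra.
  have : (Cp + 1) * t <= (Cp + 1) * (eps / 2) by lra.
  by rewrite ler_pM2l.
(* The variance of [k (X w)] is nonnegative. Hence the variance of the bounded part,
   [s2 - t - m ^+ 2], is at least [s2 - 2 * t]. *)
have m2t : m ^+ 2 <= t by move: v20; rewrite mm'; lra.
exists (fun x => h x - m), (fun x => k x + m), (b + `|m|), `|m|,
  (h2 + 2 * (- m) * m + (- m) ^+ 2), (t + 2 * m * m' + m ^+ 2).
split.
- by split; apply: measurable_funD.
- split.
  + by move=> x; rewrite {1}(hk x); ring.
  + by move=> x; rewrite (le_trans (ler_normB _ _))// lerD.
  + by move=> x; rewrite (le_trans (ler_normD _ _))// lerD.
- split=> //.
  + by rewrite f1 subrr.
  + by rewrite g1 mm' addNr.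
- split=> //.
  + by rewrite ltr_wpDr.
  + rewrite s2E; lra.
  + rewrite v20 mm'/=; have := sqr_ge0 m; lra.
Qed.

End moments.

(** * Proof of the theorem *)

Section main.
Context {R : realType} {dT : measure_display} {T : measurableType dT}.
Variable P : probability T R.
Variables (d : nat) (alpha beta sigma p Cp : R).
Variables (X : {RV P >-> R}) (Xs : {ffun 'I_d -> nat} -> {RV P >-> R}).
Hypotheses (d0 : (0 < d)%N) (a01 : 0 < alpha < 1) (b1 : 1 < beta).
Hypothesis indXs : mutually_independent (Zpos d) Xs.
Hypothesis distXs : forall k, Zpos d k -> same_distribution (Xs k) X.
Hypothesis iX : P.-integrable setT (EFin \o X).
Hypothesis X0 : (\int[P]_w (X w)%:E = 0)%E.
Hypothesis X2 : (\int[P]_w ((X w) ^+ 2)%:E = (sigma ^+ 2)%:E)%E.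
Hypothesis sigma0 : 0 <= sigma.
Hypothesis Xp : (\int[P]_w (`|X w| `^ p)%:E <= Cp%:E)%E.
Hypothesis p2 : 2 < p.
Hypothesis thp : (beta / (1 - alpha))^-1 < alpha * (p / 2 - 1).
Implicit Types n : {ffun 'I_d -> nat}.

Let theta : R := beta / (1 - alpha).
Let th0 : 0 < theta.
Proof. by apply: divr_gt0; [exact: lt_trans ltr01 b1|rewrite subr_gt0; case/andP: a01]. Qed.

Let mX : measurable_fun setT X. Proof. by []. Qed.

Lemma comp_independent (f : {mfun R >-> R}) :
  mutually_independent (Zpos d) (fun k => (f \o Xs k) : {RV P >-> R}).
Proof.
move=> s B us sD mB.
have := indXs s (fun i => f @^-1` B i) us sD; apply => i.
exact: measurable_funPTI.
Qed.

Lemma ae_normalized_sum_comp_lt (f : R -> R) (M v c : R) :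
  measurable_fun setT f -> 0 <= M -> (forall x, `|f x| <= `|x| + M) ->
  (\int[P]_w (f (X w))%:E = 0)%E -> (\int[P]_w ((f (X w)) ^+ 2)%:E = v%:E)%E ->
  0 < c -> v < c ^+ 2 * theta ->
  {ae P, forall w, exists N, forall n, (forall k, LambdaStar alpha beta (n k)) ->
     (forall k, N <= n k)%N -> normalized_sum d alpha (fun k w => f (Xs k w)) n w < c}.
Proof.
move=> mf M0 fM f0 f2 c0 vc.
pose F : {mfun R >-> R} := mfun_Sub (mem_set mf).
have p0 : 0 <= p by have := p2; lra.
have [C C0 XC] := moment_le P X p p0 f Cp M mf Xp M0 fM.
have v0 : 0 <= v.
  by rewrite -lee_fin -f2; apply: integral_ge0 => w _; rewrite lee_fin sqr_ge0.
have trans (g : R -> R) i : measurable_fun setT g -> Zpos d i ->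
    (\int[P]_w (g (Xs i w))%:E = \int[P]_w (g (X w))%:E)%E.
  move=> mg Di; apply: (same_distribution_integral P (Xs i) X (EFin \o g)); last exact: distXs.
  exact/measurable_EFinP.
have mfX : measurable_fun setT (fun w => f (X w)) by exact: measurableT_comp mf mX.
have iM : P.-integrable setT (fun w => (`|X w| + M)%:E).
  under eq_fun do rewrite EFinD.
  apply: integrableD => //; last exact: finite_measure_integrable_cst.
  exact: integrable_norm iX.
have ifX : P.-integrable setT (fun w => (f (X w))%:E).
  apply: le_integrable iM => //; first exact/measurable_EFinP.
  by move=> w _ /=; rewrite lee_fin [leRHS]ger0_norm ?addr_ge0.
have := ae_normalized_sum_lt P d alpha beta d0 a01 b1
  (fun k => (F \o Xs k) : {RV P >-> R}) (comp_independent F) v p C c v0 C0 c0 vc p2 thp.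
apply.
- move=> i Di; apply/integrableP; split.
    by apply/measurable_EFinP; exact: measurableT_comp.
  have -> : (\int[P]_x `|(EFin \o (F \o Xs i)) x| = \int[P]_x (`|f (X x)|)%:E)%E.
    by rewrite -(trans (fun x => `|f x|) i)//; exact: measurableT_comp.
  by have /integrableP[] := ifX.
- by move=> i Di; rewrite -f0 -(trans f i).
- move=> i Di; rewrite -f2 -(trans (fun x => f x ^+ 2) i)//; exact: measurable_funX.
- move=> i Di; apply: le_trans XC.
  rewrite -(trans (fun x => `|f x| `^ p) i)//.
  by apply: (measurableT_comp (@measurable_powR R p)); exact: measurableT_comp.
Qed.

Lemma ae_normalized_sum_comp_ge (f : R -> R) (B v c : R) :
  measurable_fun setT f -> 0 < B -> (forall x, `|f x| <= B) ->
  (\int[P]_w (f (X w))%:E = 0)%E -> (\int[P]_w ((f (X w)) ^+ 2)%:E = v%:E)%E ->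
  0 < v -> 0 <= c -> c < Num.sqrt (v / theta) ->
  {ae P, forall w, forall N, exists n : {ffun 'I_d -> nat}, [/\ forall k, LambdaStar alpha beta (n k),
     (forall k, N <= n k)%N & c <= normalized_sum d alpha (fun k w => f (Xs k w)) n w]}.
Proof.
move=> mf B0 fB f0 f2 v0 c0 cv.
pose F : {mfun R >-> R} := mfun_Sub (mem_set mf).
have trans (g : R -> R) i : measurable_fun setT g -> Zpos d i ->
    (\int[P]_w (g (Xs i w))%:E = \int[P]_w (g (X w))%:E)%E.
  move=> mg Di; apply: (same_distribution_integral P (Xs i) X (EFin \o g)); last exact: distXs.
  exact/measurable_EFinP.
have := ae_normalized_sum_ge P d alpha beta d0 a01 b1
  (fun k => (F \o Xs k) : {RV P >-> R}) (comp_independent F) v B c v0 B0 c0 cv.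
apply.
- by move=> i w _; exact: fB.
- by move=> i Di; rewrite -f0 -(trans f i).
- move=> i Di; rewrite -f2 -(trans (fun x => f x ^+ 2) i)//; exact: measurable_funX.
Qed.

Let l : R := sigma * Num.sqrt ((1 - alpha) / beta).

Let l0 : 0 <= l. Proof. by rewrite mulr_ge0 ?sqrtr_ge0. Qed.

Let lE : l ^+ 2 * theta = sigma ^+ 2.
Proof.
have bp : 0 < beta by exact: lt_trans ltr01 b1.
have ap : 0 < 1 - alpha by rewrite subr_gt0; case/andP: a01.
rewrite exprMn sqr_sqrtr; last by rewrite divr_ge0// ltW.
by rewrite /theta; field; rewrite !gt_eqF.
Qed.

Lemma normalized_sumZ (s : R) n w : normalized_sum d alpha (fun k w => s * Xs k w) n w =
  s * normalized_sum d alpha (fun k => Xs k : T -> R) n w.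
Proof. by rewrite /normalized_sum /Tbox -mulr_sumr mulrA. Qed.

(** The sign [s] lets one statement serve [X] and [- X], hence both limits. *)
Lemma ae_normalized_sum_upper (s eta : R) : `|s| = 1 -> 0 < eta ->
  {ae P, forall w, exists N, forall n, (forall k, LambdaStar alpha beta (n k)) ->
     (forall k, N <= n k)%N -> s * normalized_sum d alpha (fun k => Xs k : T -> R) n w < l + eta}.
Proof.
move=> s1 eta0.
have s2 : s ^+ 2 = 1 by rewrite -real_normK ?num_real// s1 expr1n.
have mf : measurable_fun setT (fun x : R => s * x) by exact: measurable_funM.
have bnd (x : R) : `|s * x| <= `|x| + 0 by rewrite normrM s1 mul1r addr0.
have f0 : (\int[P]_w (s * X w)%:E = 0)%E.
  under eq_integral do rewrite EFinM.
  by rewrite integralZl// X0 mule0.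
have f2 : (\int[P]_w ((s * X w) ^+ 2)%:E = (sigma ^+ 2)%:E)%E.
  by rewrite -X2; apply: eq_integral => w _; rewrite exprMn s2 mul1r.
have c0 : 0 < l + eta by rewrite ltr_wpDl.
have vc : sigma ^+ 2 < (l + eta) ^+ 2 * theta.
  by rewrite -lE ltr_pM2r// ltrXn2r ?nnegrE ?ltrDl// ltW.
have := ae_normalized_sum_comp_lt _ 0 _ (l + eta) mf (lexx 0) bnd f0 f2 c0 vc.
by apply: filterS => w [N hN]; exists N => n nL nN; rewrite -normalized_sumZ; exact: hN.
Qed.

Lemma ae_normalized_sum_lower (s eta : R) : `|s| = 1 -> 0 < eta ->
  {ae P, forall w, forall N, exists n : {ffun 'I_d -> nat}, [/\ forall k, LambdaStar alpha beta (n k),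
     (forall k, N <= n k)%N & l - eta <= s * normalized_sum d alpha (fun k => Xs k : T -> R) n w]}.
Proof.
move=> s1 eta0.
have s2 : s ^+ 2 = 1 by rewrite -real_normK ?num_real// s1 expr1n.
(* For [sigma = 0] the bounded part need not have positive variance. Here [l = 0], and the upper
   bound for [- s] gives the claim at every far lattice point. *)
have [sig0|sig0] := eqVneq sigma 0.
  have s1N : `|- s| = 1 by rewrite normrN.
  have := ae_normalized_sum_upper (- s) eta s1N eta0; apply: filterS => w [N0 hN] N.
  have th1 : 1 <= theta.
    have ap : 0 < 1 - alpha by rewrite subr_gt0; case/andP: a01.
    by rewrite ler_pdivlMr// mul1r; have := b1; case/andP: a01; lra.
  pose i : {ffun 'I_d -> nat} := [ffun=> (N0 + N).+1].
  have i0 k : (0 < i k)%N by rewrite ffunE.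
  have iN k : (N0 + N <= lattice_point d theta i k)%N.
    by rewrite ffunE (leq_trans _ (nu_ge theta th1 _))// ffunE.
  exists (lattice_point d theta i); split.
  - exact: LambdaStar_point.
  - by move=> k; exact: leq_trans (leq_addl _ _) (iN k).
  - have := hN _ (LambdaStar_point d alpha beta i i0) (fun k => leq_trans (leq_addr _ _) (iN k)).
    rewrite /l sig0 mul0r mulNr; lra.
have sp : 0 < sigma by rewrite lt_neqAle eq_sym sig0.
have lp : 0 < l.
  rewrite /l mulr_gt0// sqrtr_gt0 divr_gt0//; last exact: lt_trans ltr01 b1.
  by rewrite subr_gt0; case/andP: a01.
pose c1 := Num.max 0 (l - eta / 2).
have c10 : 0 <= c1 by rewrite le_max lexx.
have c1l : c1 < l by rewrite gt_max lp; lra.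
have c12 : c1 ^+ 2 * theta < sigma ^+ 2.
  by rewrite -lE ltr_pM2r// ltrXn2r ?nnegrE.
pose c2 := eta / 2.
have c20 : 0 < c2 by rewrite divr_gt0.
have c22 : 0 < c2 ^+ 2 * theta by rewrite mulr_gt0// exprn_gt0.
(* Small enough that the bounded part, of variance at least [sigma ^+ 2 - eps], exceeds the level
   [c1] infinitely often, and that the rest, of variance at most [eps], stays eventually below
   [c2]. *)
pose eps := Num.min (c2 ^+ 2 * theta) (sigma ^+ 2 - c1 ^+ 2 * theta) / 2.
have eps0 : 0 < eps.
  by apply: divr_gt0 => //; rewrite lt_min c22 subr_gt0.
have eps1 : eps < c2 ^+ 2 * theta.
  have : Num.min (c2 ^+ 2 * theta) (sigma ^+ 2 - c1 ^+ 2 * theta) <= c2 ^+ 2 * theta by rewrite ge_min lexx.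
  rewrite /eps; have := c22; lra.
have eps2 : c1 ^+ 2 * theta < sigma ^+ 2 - eps.
  have : Num.min (c2 ^+ 2 * theta) (sigma ^+ 2 - c1 ^+ 2 * theta) <= sigma ^+ 2 - c1 ^+ 2 * theta.
    by rewrite ge_min lexx orbT.
  rewrite /eps; have := c12; lra.
have [f [g [B [M [v1 [v2 [[mf mg] [fgE fB gM] [f0 g0 f2 g2] [B0 M0 v1e /andP[v20 v2e]]]]]]]]] :=
  truncation_decomposition P X p (sigma ^+ 2) eps Cp p2 iX X0 X2 Xp eps0.
have v10 : 0 < v1.
  apply: lt_le_trans v1e; apply: le_lt_trans eps2.
  by rewrite mulr_ge0 ?sqr_ge0// ltW.
have sf0 : (\int[P]_w (s * f (X w))%:E = 0)%E.
  have if0 : P.-integrable setT (fun w => (f (X w))%:E).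
    apply: (@le_integrable _ _ _ _ _ measurableT _ (fun=> B%:E)).
    - by apply/measurable_EFinP; exact: measurableT_comp mf mX.
    - by move=> w _ /=; rewrite lee_fin [leRHS]ger0_norm// ltW.
    - exact: finite_measure_integrable_cst.
  under eq_integral do rewrite EFinM.
  by rewrite integralZl// f0 mule0.
have sg0 : (\int[P]_w (- s * g (X w))%:E = 0)%E.
  have ig0 : P.-integrable setT (fun w => (g (X w))%:E).
    have iM : P.-integrable setT (fun w => (`|X w| + M)%:E).
      under eq_fun do rewrite EFinD.
      apply: integrableD => //; last exact: finite_measure_integrable_cst.
      exact: integrable_norm iX.
    apply: le_integrable iM => //.
      by apply/measurable_EFinP; exact: measurableT_comp mg mX.
    by move=> w _ /=; rewrite lee_fin [leRHS]ger0_norm ?addr_ge0.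
  under eq_integral do rewrite EFinM.
  by rewrite integralZl// g0 mule0.
have sf2 : (\int[P]_w ((s * f (X w)) ^+ 2)%:E = v1%:E)%E.
  by rewrite -f2; apply: eq_integral => w _; rewrite exprMn s2 mul1r.
have sg2 : (\int[P]_w ((- s * g (X w)) ^+ 2)%:E = v2%:E)%E.
  by rewrite -g2; apply: eq_integral => w _; rewrite exprMn sqrrN s2 mul1r.
have msf : measurable_fun setT (fun x => s * f x) by exact: measurable_funM.
have msg : measurable_fun setT (fun x => - s * g x) by exact: measurable_funM.
have sfB x : `|s * f x| <= B by rewrite normrM s1 mul1r.
have sgM x : `|- s * g x| <= `|x| + M by rewrite normrM normrN s1 mul1r.
have c1v : c1 < Num.sqrt (v1 / theta).
  have vth : 0 < v1 / theta by exact: divr_gt0.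
  rewrite -[ltLHS]ger0_norm// -sqrtr_sqr ltr_sqrt//.
  by rewrite ltr_pdivlMr//; apply: lt_le_trans v1e.
have := ae_normalized_sum_comp_ge _ B v1 c1 msf B0 sfB sf0 sf2 v10 c10 c1v.
have := ae_normalized_sum_comp_lt _ M v2 c2 msg M0 sgM sg0 sg2 c20 (le_lt_trans v2e eps1).
apply: filterS2 => w [N0 hN0] hN N.
have [n [nL nN cn]] := hN (N0 + N)%N.
exists n; split=> //.
  by move=> k; exact: leq_trans (leq_addl _ _) (nN k).
have := hN0 n nL (fun k => leq_trans (leq_addr _ _) (nN k)).
(* By linearity the sum for [s * X] is the one for [s * f X], at least [c1], minus the one for
   [- s * g X], less than [c2]; and [c1 - c2 >= l - eta]. *)
have -> : normalized_sum d alpha (fun k w => - s * g (Xs k w)) n w =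
  normalized_sum d alpha (fun k w => s * f (Xs k w)) n w
  - s * normalized_sum d alpha (fun k => Xs k : T -> R) n w.
  rewrite -normalized_sumZ /normalized_sum -mulrBl; congr (_ / _).
  rewrite /Tbox -sumrB; apply: eq_bigr => t _.
  set z := Xs _ w; have -> : s * z = s * (f z + g z) by rewrite -fgE.
  ring.
have : l - eta / 2 <= c1 by rewrite le_max lexx orbT.
have c2E : c2 = eta / 2 by [].
move=> hc h2; lra.
Qed.

End main.

Theorem theorem6p1 (R : realType) (dT : measure_display) (T : measurableType dT)
  (P : probability T R) (d : nat) (alpha beta sigma : R)
  (X : {RV P >-> R}) (Xs : {ffun 'I_d -> nat} -> {RV P >-> R}) :
  (1 <= d)%N -> 0 < alpha < 1 -> 1 < beta ->
  mutually_independent (Zpos d) Xs ->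
  (forall k, Zpos d k -> same_distribution (Xs k) X) ->
  P.-integrable setT (EFin \o X) ->
  ('E_P[X] = 0)%E ->
  (X : T -> R) \in Lfun P 2%:E -> 0 <= sigma -> 'V_P[X] = (sigma ^+ 2)%:E ->
  P.-integrable setT (fun w => (`|X w| `^ (2 / alpha)
       * logplus `|X w| `^ (d%:R - 1 - alpha^-1))%:E) ->
  let a := fun n w => Tbox (fun k => Xs k : T -> R) n (npow alpha n) w
                       / Num.sqrt (2 * ((normprod n)%:R `^ alpha) * ln (normprod n)%:R) in
  let F := to_infty_in d (LambdaStar alpha beta) in
  {ae P, forall w,
    limsup_along (fun n => (a n w)%:E) F = (sigma * Num.sqrt ((1 - alpha) / beta))%:E /\
    liminf_along (fun n => (a n w)%:E) F = (- (sigma * Num.sqrt ((1 - alpha) / beta)))%:E}.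
Proof.
move=> d0 a01 b1 indXs distXs iX EX XL sigma0 VX iXm a F.
have [a0 a1] := andP a01.
have bp : 0 < beta by exact: lt_trans ltr01 b1.
have a1p : 0 < 1 - alpha by rewrite subr_gt0.
have X0 : (\int[P]_w (X w)%:E = 0)%E by move: EX; rewrite unlock.
have X2 : (\int[P]_w ((X w) ^+ 2)%:E = (sigma ^+ 2)%:E)%E.
  move: VX; rewrite varianceE// EX expe2 mule0 sube0 => <-.
  by rewrite unlock.
pose rth := (1 - alpha) / beta.
have rth0 : 0 < rth by exact: divr_gt0.
have rth1 : rth < 1 - alpha by rewrite ltr_pdivrMr// ltr_pMr.
(* Here [rth] is the inverse of [theta], and [alpha * p] is the midpoint of [2 * (alpha + rth)] and
   2. These bounds express [thp] and [pa], and they are compatible because [beta > 1] gives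
   [rth < 1 - alpha]. *)
pose p := alpha^-1 * (1 + alpha + rth).
have ap : alpha * p = 1 + alpha + rth by rewrite /p mulrA divff ?mul1r// gt_eqF.
have p2 : 2 < p.
  rewrite -(ltr_pM2l a0) ap; lra.
have pa : p < 2 / alpha.
  rewrite -(ltr_pM2l a0) ap mulrCA divff ?gt_eqF// mulr1; lra.
have thp : (beta / (1 - alpha))^-1 < alpha * (p / 2 - 1).
  rewrite invf_div -/rth.
  have -> : alpha * (p / 2 - 1) = (alpha * p) / 2 - alpha by ring.
  rewrite ap; lra.
have [C C0 XC] := logplus_powR_bound (2 / alpha) p (d%:R - 1 - alpha^-1) (lt_trans (ltr0Sn _ _) p2) pa.
have mX : measurable_fun setT X by [].
have [Cp Xp] : exists Cp, (\int[P]_w (`|X w| `^ p)%:E <= Cp%:E)%E.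
  pose G w := `|X w| `^ (2 / alpha) * logplus `|X w| `^ (d%:R - 1 - alpha^-1).
  have iG : P.-integrable setT (fun w => (1 + C * G w)%:E).
    under eq_fun do rewrite EFinD EFinM.
    apply: integrableD => //; first exact: finite_measure_integrable_cst.
    exact: integrableZl.
  have mpw : measurable_fun setT (fun w => `|X w| `^ p).
    by apply: (measurableT_comp (@measurable_powR R p)); exact: measurableT_comp.
  exists (fine (\int[P]_w (1 + C * G w)%:E)).
  rewrite fineK; last exact: integrable_fin_num.
  apply: ge0_le_integral => //.
  - exact/measurable_EFinP.
  - by have /integrableP[] := iG.
  - by move=> w _; rewrite lee_fin XC.
pose l := sigma * Num.sqrt ((1 - alpha) / beta).
(* The errors run through the sequence [m.+1%:R^-1], so that countably many almost sure events are
   intersected. *)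
have up s (m : nat) (s1 : `|s| = 1) := ae_normalized_sum_upper P d alpha beta sigma p Cp X Xs
  d0 a01 b1 indXs distXs iX X0 X2 sigma0 Xp p2 thp s m.+1%:R^-1 s1 (ltac:(by rewrite invr_gt0)).
have lo s (m : nat) (s1 : `|s| = 1) := ae_normalized_sum_lower P d alpha beta sigma p Cp X Xs
  d0 a01 b1 indXs distXs iX X0 X2 sigma0 Xp p2 thp s m.+1%:R^-1 s1 (ltac:(by rewrite invr_gt0)).
have sN1 : `|-1 : R| = 1 by rewrite normrN1.
have small (eta : R) : 0 < eta -> exists m : nat, (m.+1%:R : R)^-1 <= eta.
  move=> eta0; exists (Num.truncn eta^-1).
  rewrite -[leRHS]invrK lef_pV2 ?posrE ?invr_gt0//.
  exact/ltW/truncnS_gt.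
have /ae_foralln up1 := fun m => up 1 m (normr1 R).
have /ae_foralln up2 := fun m => up (-1) m sN1.
have /ae_foralln lo1 := fun m => lo 1 m (normr1 R).
have /ae_foralln lo2 := fun m => lo (-1) m sN1.
have FV N : F [set n : {ffun 'I_d -> nat} |
   (forall i, LambdaStar alpha beta (n i)) /\ (forall i, (N <= n i)%N)] by exists N.
have aE n w : normalized_sum d alpha (fun k => Xs k : T -> R) n w = a n w by [].
apply: filterS (filterI (filterI up1 lo1) (filterI up2 lo2)) => w [[U1 L1] [U2 L2]].
split.
- apply: limsup_along_eq => [eta eta0|eta V eta0 [N NV]].
    have [m meta] := small eta eta0; have [N hN] := U1 m.
    eexists; first exact: (FV N).
    move=> n [nL nN]; have := hN n nL nN; rewrite mul1r aE -/l => h.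
    by apply: ltW; apply: lt_le_trans h _; rewrite lerD2l.
  have [m meta] := small eta eta0; have [n [nL nN h]] := L1 m N.
  exists n; first exact: NV.
  by move: h; rewrite mul1r aE -/l; apply: le_trans; rewrite lerD2l lerN2.
(* The bounds with [s = -1] change sign: the upper one gives the eventual lower bound, the lower one
   the points near the limit. *)
- apply: liminf_along_eq => [eta eta0|eta V eta0 [N NV]].
    have [m meta] := small eta eta0; have [N hN] := U2 m.
    eexists; first exact: (FV N).
    move=> n [nL nN]; have := hN n nL nN; rewrite mulN1r aE -/l.
    set y := a n w; set z := _%:R^-1 in meta * => h; lra.
  have [m meta] := small eta eta0; have [n [nL nN h]] := L2 m N.
  exists n; first exact: NV.
  move: h; rewrite mulN1r aE -/l.
  set y := a n w; set z := _%:R^-1 in meta * => h; lra.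
Qed.
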